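(* Let $\mathbb{K}$ be a field of characteristic $0$, let $n\geq 3$ and $k\geq 1$ be integers, and let $sl_n=sl_n(\mathbb{K})$ be endowed with the Vasilovsky $\mathbb{Z}_n$-grading. Then $$\mathrm{GKdim}_k^{\mathbb{Z}_n}(sl_n)=k(n^2-1)-n+1.$$
   Context: $sl_n=sl_n(\mathbb{K})$ is the Lie algebra of traceless $n\times n$ matrices over $\mathbb{K}$. The Vasilovsky $\mathbb{Z}_n$-grading on $sl_n$ is $sl_n=\bigoplus_{i\in\mathbb{Z}_n}(sl_n)_i$, where for $i\in\{0,\ldots,n-1\}$, $(sl_n)_i$ is the set of traceless matrices in $\mathrm{span}_{\mathbb{K}}\{e_{pq} : q-p\equiv i \pmod n\}$ and the $e_{pq}$ are the matrix units (so $(sl_n)_0$ consists of the traceless diagonal matrices). For an abelian group $G$ and a $G$-graded Lie algebra $L=\bigoplus_{g\in G}L_g$ over $\mathbb{K}$ with finite support $\mathrm{Supp}(L)=\{g\in G: L_g\neq 0\}=\{g_1,\ldots,g_s\}$: let $\mathcal{L}(X)$ be the free $G$-graded Lie algebra over $\mathbb{K}$ on $X=\bigcup_{g\in G}X_g$, where the $X_g=\{x_i^g : i\geq 1\}$ are disjoint infinite sets of variables of homogeneous degree $g$. A polynomial $f\in\mathcal{L}(X)$ is a $G$-graded polynomial identity of $L$ if it vanishes under every substitution of the variables $x_i^g$ by elements of $L_g$ (all $g\in G$, $i\ge 1$); $T_G(L)$ is the ideal of all $G$-graded polynomial identities of $L$. The relatively free $G$-graded algebra of $L$ in $k$ variables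 is $$\mathcal{L}_k^G(L)=\frac{\mathcal{L}(x_1^{g_1},\ldots,x_k^{g_1},\ldots,x_1^{g_s},\ldots,x_k^{g_s})}{\mathcal{L}(x_1^{g_1},\ldots,x_k^{g_1},\ldots,x_1^{g_s},\ldots,x_k^{g_s})\cap T_G(L)},$$ where $\mathcal{L}(x_1^{g_1},\ldots,x_k^{g_s})$ denotes the free Lie algebra on the listed $sk$ variables. For an algebra $A$ generated by a finite set $V$, the growth function $g_V(m)$ is the dimension of the span of all words of length at most $m$ in the elements of $V$, and $\mathrm{GKdim}(A)=\limsup_{m\to\infty}\frac{\ln g_V(m)}{\ln m}$ (independent of $V$). The $G$-graded Gelfand-Kirillov dimension of $L$ in $k$ variables is $\mathrm{GKdim}_k^G(L):=\mathrm{GKdim}(\mathcal{L}_k^G(L))$. *)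

(* Defs.v *)
From HB Require Import structures.
From mathcomp Require Import all_boot all_order all_algebra.
From mathcomp Require Import all_classical all_reals all_analysis.
From mathcomp Require Import ring.

Set Implicit Arguments.
Unset Strict Implicit.
Unset Printing Implicit Defensive.

Import Order.TTheory GRing.Theory Num.Theory.

Local Open Scope classical_set_scope.
Local Open Scope ring_scope.

Definition subspace (K : fieldType) (V : lmodType K) (W : set V) : Prop :=
  W 0 /\ forall (a : K) u v, W u -> W v -> W (a *: u + v).

Definition lspan (K : fieldType) (V : lmodType K) (S : set V) : set V :=
  [set v | exists s : seq (K * V),
     (forall p, p \in s -> S p.2) /\ v = \sum_(p <- s) p.1 *: p.2].

Definition is_basis (K : fieldType) (V : lmodType K) (W : set V) (d : nat)
    (b : d.-tuple V) : Prop :=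
  (forall c : 'I_d -> K,
     \sum_(i < d) c i *: tnth b i = 0 -> forall i, c i = 0) /\
  lspan [set` b] = W.

(* Only meaningful (and only used) for finite-dimensional W; otherwise 0. *)
Definition dimension (K : fieldType) (V : lmodType K) (W : set V) : nat :=
  xget 0%N [set d | exists b : d.-tuple V, is_basis W b].

HB.mixin Record isLieAlgebra (K : fieldType) L of GRing.Lmodule K L := {
  lie : L -> L -> L ;
  lie_linearl : forall z, linear (lie^~ z) ;
  lie_linearr : forall z, linear (lie z) ;
  liexx : forall x, lie x x = 0 ;
  lie_jacobi : forall x y z,
    lie x (lie y z) + lie y (lie z x) + lie z (lie x y) = 0
}.

#[short(type="lieAlgType")]
HB.structure Definition LieAlgebra (K : fieldType) :=
  { L of isLieAlgebra K L & GRing.Lmodule K L }.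

Lemma lieD0 (K : fieldType) (L : lieAlgType K) (x : L) :
  lie 0 x = 0 /\ lie x 0 = 0.
Proof.
have := lie_linearl x (-1) 0 0; have := lie_linearr x (-1) 0 0.
by rewrite !scaleN1r !addNr.
Qed.

Record lieIdeal (K : fieldType) (L : lieAlgType K) := LieIdeal {
  lieIdeal_set :> L -> Prop ;
  lieIdeal_subspace : subspace lieIdeal_set ;
  lieIdeal_lie : forall x y, lieIdeal_set x -> lieIdeal_set (lie y x)
}.

Definition lie_morphism (K : fieldType) (L M : lieAlgType K) (f : L -> M) :=
  linear f /\ forall x y, f (lie x y) = lie (f x) (f y).

(* A type with operations satisfying the Lie algebra axioms up to a congruence.
   Its quotient is a Lie algebra; free Lie algebras and quotients by ideals are
   both obtained in this way. *)
Record lieSetoid (K : fieldType) := LieSetoid {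
  ls_sort :> choiceType ;
  ls_eq : ls_sort -> ls_sort -> Prop ;
  ls_zero : ls_sort ;
  ls_add : ls_sort -> ls_sort -> ls_sort ;
  ls_scale : K -> ls_sort -> ls_sort ;
  ls_lie : ls_sort -> ls_sort -> ls_sort ;
  ls_refl : forall x, ls_eq x x ;
  ls_sym : forall x y, ls_eq x y -> ls_eq y x ;
  ls_trans : forall x y z, ls_eq x y -> ls_eq y z -> ls_eq x z ;
  ls_add_congr : forall x x' y y',
    ls_eq x x' -> ls_eq y y' -> ls_eq (ls_add x y) (ls_add x' y') ;
  ls_scale_congr : forall a x x', ls_eq x x' -> ls_eq (ls_scale a x) (ls_scale a x') ;
  ls_lie_congr : forall x x' y y',
    ls_eq x x' -> ls_eq y y' -> ls_eq (ls_lie x y) (ls_lie x' y') ;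
  ls_addA : forall x y z, ls_eq (ls_add x (ls_add y z)) (ls_add (ls_add x y) z) ;
  ls_addC : forall x y, ls_eq (ls_add x y) (ls_add y x) ;
  ls_add0 : forall x, ls_eq (ls_add ls_zero x) x ;
  ls_addN : forall x, ls_eq (ls_add (ls_scale (-1) x) x) ls_zero ;
  ls_scaleA : forall a b x, ls_eq (ls_scale a (ls_scale b x)) (ls_scale (a * b) x) ;
  ls_scale1 : forall x, ls_eq (ls_scale 1 x) x ;
  ls_scaleDr : forall a x y,
    ls_eq (ls_scale a (ls_add x y)) (ls_add (ls_scale a x) (ls_scale a y)) ;
  ls_scaleDl : forall a b x,
    ls_eq (ls_scale (a + b) x) (ls_add (ls_scale a x) (ls_scale b x)) ;
  ls_lie_linl : forall z a x y,
    ls_eq (ls_lie (ls_add (ls_scale a x) y) z)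
          (ls_add (ls_scale a (ls_lie x z)) (ls_lie y z)) ;
  ls_lie_linr : forall z a x y,
    ls_eq (ls_lie z (ls_add (ls_scale a x) y))
          (ls_add (ls_scale a (ls_lie z x)) (ls_lie z y)) ;
  ls_liexx : forall x, ls_eq (ls_lie x x) ls_zero ;
  ls_jacobi : forall x y z,
    ls_eq (ls_add (ls_add (ls_lie x (ls_lie y z)) (ls_lie y (ls_lie z x)))
                  (ls_lie z (ls_lie x y))) ls_zero
}.

Section LieSetoidQuotient.
Context (K : fieldType) (S : lieSetoid K).
Local Open Scope quotient_scope.

Definition ls_eqb : rel S := fun x y => `[< ls_eq x y >].

Lemma ls_eqb_equiv : equiv_class_of ls_eqb.
Proof.
split.
- by move=> x; apply/asboolP; apply: ls_refl.
- by move=> x y; apply/asboolP/asboolP; apply: ls_sym.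
- move=> y x z /asboolP xy /asboolP yz; apply/asboolP.
  exact: ls_trans xy yz.
Qed.
Canonical ls_eqb_equivRel := EquivRelPack ls_eqb_equiv.
Canonical ls_eqb_encModRel := defaultEncModRel ls_eqb.

Definition lieQuot := {eq_quot ls_eqb}.
HB.instance Definition _ := Choice.on lieQuot.
HB.instance Definition _ := EqQuotient.on lieQuot.

Definition lieQuot_pi (x : S) : lieQuot := \pi_lieQuot x.

Lemma lieQuot_piP x y : lieQuot_pi x = lieQuot_pi y <-> ls_eq x y.
Proof.
split=> [/eqP|xy]; last apply/eqP; rewrite /lieQuot_pi piE; first by move/asboolP.
exact/asboolP.
Qed.

Lemma lieQuot_piK (q : lieQuot) : lieQuot_pi (repr q) = q.
Proof. exact: reprK. Qed.

Lemma ls_repr x : ls_eq (repr (lieQuot_pi x)) x.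
Proof. by apply/lieQuot_piP; rewrite lieQuot_piK. Qed.

Definition lq_zero := lieQuot_pi (ls_zero S).
Definition lq_add (p q : lieQuot) := lieQuot_pi (ls_add (repr p) (repr q)).
Definition lq_scale (a : K) (p : lieQuot) := lieQuot_pi (ls_scale a (repr p)).
Definition lq_opp (p : lieQuot) := lq_scale (-1) p.
Definition lq_lie (p q : lieQuot) := lieQuot_pi (ls_lie (repr p) (repr q)).

Lemma lq_addE x y : lq_add (lieQuot_pi x) (lieQuot_pi y) = lieQuot_pi (ls_add x y).
Proof. by apply/lieQuot_piP; apply: ls_add_congr; apply: ls_repr. Qed.

Lemma lq_scaleE a x : lq_scale a (lieQuot_pi x) = lieQuot_pi (ls_scale a x).
Proof. by apply/lieQuot_piP; apply: ls_scale_congr; apply: ls_repr. Qed.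

Lemma lq_lieE x y : lq_lie (lieQuot_pi x) (lieQuot_pi y) = lieQuot_pi (ls_lie x y).
Proof. by apply/lieQuot_piP; apply: ls_lie_congr; apply: ls_repr. Qed.

Let lqE := (lq_addE, lq_scaleE, lq_lieE).

Lemma lq_addA : associative lq_add.
Proof.
move=> x y z; rewrite -(lieQuot_piK x) -(lieQuot_piK y) -(lieQuot_piK z) !lqE.
exact/lieQuot_piP/ls_addA.
Qed.

Lemma lq_addC : commutative lq_add.
Proof.
move=> x y; rewrite -(lieQuot_piK x) -(lieQuot_piK y) !lqE.
exact/lieQuot_piP/ls_addC.
Qed.

Lemma lq_add0 : left_id lq_zero lq_add.
Proof. by move=> x; rewrite -(lieQuot_piK x) !lqE; apply/lieQuot_piP/ls_add0. Qed.

Lemma lq_addN : left_inverse lq_zero lq_opp lq_add.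
Proof.
by move=> x; rewrite -(lieQuot_piK x) /lq_opp !lqE; apply/lieQuot_piP/ls_addN.
Qed.

HB.instance Definition _ :=
  GRing.isZmodule.Build lieQuot lq_addA lq_addC lq_add0 lq_addN.

Lemma lq_scaleA a b (v : lieQuot) : lq_scale a (lq_scale b v) = lq_scale (a * b) v.
Proof. by rewrite -(lieQuot_piK v) !lqE; apply/lieQuot_piP/ls_scaleA. Qed.

Lemma lq_scale1 : left_id 1 lq_scale.
Proof. by move=> x; rewrite -(lieQuot_piK x) !lqE; apply/lieQuot_piP/ls_scale1. Qed.

Lemma lq_scaleDr : right_distributive lq_scale +%R.
Proof.
move=> a x y; rewrite -(lieQuot_piK x) -(lieQuot_piK y) /GRing.add /= !lqE.
exact/lieQuot_piP/ls_scaleDr.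
Qed.

Lemma lq_scaleDl v : {morph lq_scale^~ v : a b / a + b}.
Proof.
move=> a b; rewrite -(lieQuot_piK v) [RHS]/GRing.add /= !lqE.
exact/lieQuot_piP/ls_scaleDl.
Qed.

HB.instance Definition _ := GRing.Zmodule_isLmodule.Build K lieQuot
  lq_scaleA lq_scale1 lq_scaleDr lq_scaleDl.

Lemma lieQuot_piD x y : lieQuot_pi (ls_add x y) = lieQuot_pi x + lieQuot_pi y.
Proof. exact: esym (lq_addE x y). Qed.

Lemma lieQuot_piZ a x : lieQuot_pi (ls_scale a x) = a *: lieQuot_pi x.
Proof. exact: esym (lq_scaleE a x). Qed.

Lemma lieQuot_pi0 : lieQuot_pi (ls_zero S) = 0.
Proof. by []. Qed.

Lemma lq_linl z : linear (lq_lie^~ z).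
Proof.
move=> a x y.
change (lq_lie (lq_add (lq_scale a x) y) z =
        lq_add (lq_scale a (lq_lie x z)) (lq_lie y z)).
rewrite -(lieQuot_piK x) -(lieQuot_piK y) -(lieQuot_piK z) !lqE.
exact/lieQuot_piP/ls_lie_linl.
Qed.

Lemma lq_linr z : linear (lq_lie z).
Proof.
move=> a x y.
change (lq_lie z (lq_add (lq_scale a x) y) =
        lq_add (lq_scale a (lq_lie z x)) (lq_lie z y)).
rewrite -(lieQuot_piK x) -(lieQuot_piK y) -(lieQuot_piK z) !lqE.
exact/lieQuot_piP/ls_lie_linr.
Qed.

Lemma lq_liexx x : lq_lie x x = 0.
Proof. by rewrite -(lieQuot_piK x) lq_lieE; apply/lieQuot_piP/ls_liexx. Qed.

Lemma lq_jacobi x y z :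
  lq_lie x (lq_lie y z) + lq_lie y (lq_lie z x) + lq_lie z (lq_lie x y) = 0.
Proof.
rewrite -(lieQuot_piK x) -(lieQuot_piK y) -(lieQuot_piK z) !lq_lieE.
by rewrite -!lieQuot_piD; apply/lieQuot_piP/ls_jacobi.
Qed.

HB.instance Definition _ :=
  isLieAlgebra.Build K lieQuot lq_linl lq_linr lq_liexx lq_jacobi.

Lemma lieQuot_pi_lie x y :
  lieQuot_pi (ls_lie x y) = lie (lieQuot_pi x) (lieQuot_pi y).
Proof. exact: esym (lq_lieE x y). Qed.

End LieSetoidQuotient.

Section IdealQuotient.
Context (K : fieldType) (L : lieAlgType K) (I : lieIdeal L).

Definition ideal_eq (x y : L) : Prop := I (x - y).

Lemma ideal0 : I 0. Proof. by have [] := lieIdeal_subspace I. Qed.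
Lemma idealZ a x : I x -> I (a *: x).
Proof.
by move=> Ix; have [I0 /(_ a x 0 Ix I0)] := lieIdeal_subspace I; rewrite addr0.
Qed.
Lemma idealD x y : I x -> I y -> I (x + y).
Proof.
by move=> Ix Iy; have [_ /(_ 1 x y Ix Iy)] := lieIdeal_subspace I; rewrite scale1r.
Qed.

Lemma ideal_eq_refl x y : x = y -> ideal_eq x y.
Proof. by move=> ->; rewrite /ideal_eq subrr; apply: ideal0. Qed.

Lemma ideal_eq_sym x y : ideal_eq x y -> ideal_eq y x.
Proof. by move=> /(@idealZ (-1)); rewrite scaleN1r opprB. Qed.

Lemma ideal_eq_trans x y z : ideal_eq x y -> ideal_eq y z -> ideal_eq x z.
Proof. by move=> xy /(idealD xy); rewrite addrA subrK. Qed.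

Lemma ideal_eqD x x' y y' :
  ideal_eq x x' -> ideal_eq y y' -> ideal_eq (x + y) (x' + y').
Proof. by move=> xx /(idealD xx); rewrite /ideal_eq opprD addrACA. Qed.

Lemma ideal_eqZ a x x' : ideal_eq x x' -> ideal_eq (a *: x) (a *: x').
Proof. by move=> /(@idealZ a); rewrite /ideal_eq scalerBr. Qed.

Lemma lieBl (x y z : L) : lie (x - y) z = lie x z - lie y z.
Proof.
have := lie_linearl z (-1) y x.
by rewrite !scaleN1r ![- _ + _]addrC.
Qed.

Lemma lieBr (x y z : L) : lie z (x - y) = lie z x - lie z y.
Proof.
have := lie_linearr z (-1) y x.
by rewrite !scaleN1r ![- _ + _]addrC.
Qed.

Lemma lieC (x y : L) : lie x y = - lie y x.
Proof.
have := liexx (x - y); rewrite lieBl !lieBr !liexx sub0r subr0.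
by move/eqP; rewrite subr_eq0 eqr_oppLR => /eqP.
Qed.

Lemma ideal_eq_lie x x' y y' :
  ideal_eq x x' -> ideal_eq y y' -> ideal_eq (lie x y) (lie x' y').
Proof.
move=> xx yy; apply: (@ideal_eq_trans _ (lie x y')).
  by rewrite /ideal_eq -lieBr; apply: lieIdeal_lie.
rewrite /ideal_eq -lieBl lieC -scaleN1r.
by apply: idealZ; apply: lieIdeal_lie.
Qed.

Definition idealSetoid : lieSetoid K.
Proof.
apply: (@LieSetoid K L ideal_eq 0 +%R *:%R lie).
- by move=> x; apply: ideal_eq_refl.
- exact: ideal_eq_sym.
- exact: ideal_eq_trans.
- exact: ideal_eqD.
- exact: ideal_eqZ.
- exact: ideal_eq_lie.
- by move=> *; apply: ideal_eq_refl; rewrite addrA.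
- by move=> *; apply: ideal_eq_refl; rewrite addrC.
- by move=> *; apply: ideal_eq_refl; rewrite add0r.
- by move=> *; apply: ideal_eq_refl; rewrite scaleN1r addNr.
- by move=> *; apply: ideal_eq_refl; rewrite scalerA.
- by move=> *; apply: ideal_eq_refl; rewrite scale1r.
- by move=> *; apply: ideal_eq_refl; rewrite scalerDr.
- by move=> *; apply: ideal_eq_refl; rewrite scalerDl.
- by move=> *; apply: ideal_eq_refl; rewrite lie_linearl.
- by move=> *; apply: ideal_eq_refl; rewrite lie_linearr.
- by move=> *; apply: ideal_eq_refl; rewrite liexx.
- by move=> *; apply: ideal_eq_refl; rewrite lie_jacobi.
Defined.

Definition idealQuot : lieAlgType K := lieQuot idealSetoid.

Definition idealQuot_pi : L -> idealQuot := @lieQuot_pi K idealSetoid.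

Lemma idealQuot_pi_eq0 x : idealQuot_pi x = 0 <-> I x.
Proof.
have -> : (0 : idealQuot) = idealQuot_pi 0 by [].
split=> [/lieQuot_piP|Ix]; last apply/lieQuot_piP; by rewrite /= /ideal_eq subr0.
Qed.

Lemma idealQuot_pi_morphism : lie_morphism idealQuot_pi.
Proof.
split=> [a x y|x y]; last exact: lieQuot_pi_lie.
exact: etrans (lieQuot_piD _ _) (congr1 (+%R^~ _) (lieQuot_piZ _ _)).
Qed.

Lemma idealQuot_pi_surj (q : idealQuot) : exists x, q = idealQuot_pi x.
Proof. by exists (repr q); rewrite /idealQuot_pi lieQuot_piK. Qed.

End IdealQuotient.

Inductive lieTerm (K : fieldType) (X : Type) : Type :=
| TVar of X
| TZero
| TAdd of lieTerm K X & lieTerm K X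
| TScale of K & lieTerm K X
| TLie of lieTerm K X & lieTerm K X.
Arguments TVar {K X}.
Arguments TZero {K X}.

HB.instance Definition _ K X := gen_eqMixin (lieTerm K X).
HB.instance Definition _ K X := gen_choiceMixin (lieTerm K X).

(* The least congruence making terms into a Lie algebra. *)
Inductive term_eq (K : fieldType) (X : Type) : lieTerm K X -> lieTerm K X -> Prop :=
| te_refl x : term_eq x x
| te_sym x y : term_eq x y -> term_eq y x
| te_trans x y z : term_eq x y -> term_eq y z -> term_eq x z
| te_add_congr x x' y y' :
    term_eq x x' -> term_eq y y' -> term_eq (TAdd x y) (TAdd x' y')
| te_scale_congr a x x' : term_eq x x' -> term_eq (TScale a x) (TScale a x')
| te_lie_congr x x' y y' :
    term_eq x x' -> term_eq y y' -> term_eq (TLie x y) (TLie x' y')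
| te_addA x y z : term_eq (TAdd x (TAdd y z)) (TAdd (TAdd x y) z)
| te_addC x y : term_eq (TAdd x y) (TAdd y x)
| te_add0 x : term_eq (TAdd TZero x) x
| te_addN x : term_eq (TAdd (TScale (-1) x) x) TZero
| te_scaleA a b x : term_eq (TScale a (TScale b x)) (TScale (a * b) x)
| te_scale1 x : term_eq (TScale 1 x) x
| te_scaleDr a x y :
    term_eq (TScale a (TAdd x y)) (TAdd (TScale a x) (TScale a y))
| te_scaleDl a b x :
    term_eq (TScale (a + b) x) (TAdd (TScale a x) (TScale b x))
| te_lie_linl z a x y :
    term_eq (TLie (TAdd (TScale a x) y) z) (TAdd (TScale a (TLie x z)) (TLie y z))
| te_lie_linr z a x y :
    term_eq (TLie z (TAdd (TScale a x) y)) (TAdd (TScale a (TLie z x)) (TLie z y))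
| te_liexx x : term_eq (TLie x x) TZero
| te_jacobi x y z :
    term_eq (TAdd (TAdd (TLie x (TLie y z)) (TLie y (TLie z x)))
                  (TLie z (TLie x y))) TZero.

Section FreeLie.
Context (K : fieldType) (X : Type).

Definition termSetoid : lieSetoid K :=
  @LieSetoid K (lieTerm K X) (@term_eq K X) TZero (@TAdd K X) (@TScale K X)
    (@TLie K X) (@te_refl K X) (@te_sym K X) (@te_trans K X)
    (@te_add_congr K X) (@te_scale_congr K X) (@te_lie_congr K X)
    (@te_addA K X) (@te_addC K X) (@te_add0 K X) (@te_addN K X)
    (@te_scaleA K X) (@te_scale1 K X) (@te_scaleDr K X) (@te_scaleDl K X)
    (@te_lie_linl K X) (@te_lie_linr K X) (@te_liexx K X) (@te_jacobi K X).

Definition freeLie : lieAlgType K := lieQuot termSetoid.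

Definition free_pi : lieTerm K X -> freeLie := @lieQuot_pi K termSetoid.

Lemma free_piD s t : free_pi (TAdd s t) = free_pi s + free_pi t.
Proof. exact: (@lieQuot_piD K termSetoid). Qed.

Lemma free_piZ a t : free_pi (TScale a t) = a *: free_pi t.
Proof. exact: (@lieQuot_piZ K termSetoid). Qed.

Lemma free_pi_lie s t : free_pi (TLie s t) = lie (free_pi s) (free_pi t).
Proof. exact: (@lieQuot_pi_lie K termSetoid). Qed.

Lemma free_piK f : free_pi (repr f) = f.
Proof. exact: lieQuot_piK. Qed.

Definition free_var (x : X) : freeLie := free_pi (TVar x).

Section Eval.
Context (L : lieAlgType K) (phi : X -> L).

Fixpoint term_eval (t : lieTerm K X) : L :=
  match t with
  | TVar x => phi x
  | TZero => 0
  | TAdd s t => term_eval s + term_eval t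
  | TScale a t => a *: term_eval t
  | TLie s t => lie (term_eval s) (term_eval t)
  end.

Lemma term_eval_eq s t : term_eq s t -> term_eval s = term_eval t.
Proof.
elim=> //=.
- by move=> x y z _ -> _ ->.
- by move=> x x' y y' _ -> _ ->.
- by move=> a x x' _ ->.
- by move=> x x' y y' _ -> _ ->.
- by move=> *; rewrite addrA.
- by move=> *; rewrite addrC.
- by move=> *; rewrite add0r.
- by move=> *; rewrite scaleN1r addNr.
- by move=> *; rewrite scalerA.
- by move=> *; rewrite scale1r.
- by move=> *; rewrite scalerDr.
- by move=> *; rewrite scalerDl.
- by move=> *; rewrite lie_linearl.
- by move=> *; rewrite lie_linearr.
- by move=> *; rewrite liexx.
- by move=> *; rewrite lie_jacobi.
Qed.

(* The value of the Lie polynomial f under the substitution phi. *)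
Definition lie_eval (f : freeLie) : L := term_eval (repr f).

Lemma lie_eval_pi t : lie_eval (free_pi t) = term_eval t.
Proof. exact: term_eval_eq (@ls_repr K termSetoid t). Qed.

Lemma lie_eval_var x : lie_eval (free_var x) = phi x.
Proof. exact: lie_eval_pi. Qed.

Lemma lie_eval_morphism : lie_morphism lie_eval.
Proof.
split=> [a x y|x y]; rewrite -(free_piK x) -(free_piK y).
  by rewrite -free_piZ -free_piD !lie_eval_pi.
by rewrite -free_pi_lie !lie_eval_pi.
Qed.

Lemma lie_eval_unique (h : freeLie -> L) : lie_morphism h ->
  (forall x, h (free_var x) = phi x) -> h =1 lie_eval.
Proof.
move=> [hlin hlie] hvar f; rewrite -(free_piK f) lie_eval_pi.
have h0 : h 0 = 0.
  by have := hlin (-1) 0 0; rewrite !scaleN1r !addNr.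
have hD x y : h (x + y) = h x + h y.
  by have := hlin 1 x y; rewrite !scale1r.
have hZ a x : h (a *: x) = a *: h x.
  by have := hlin a x 0; rewrite h0 !addr0.
elim: (repr f) => [x||s IHs t IHt|a t IHt|s IHs t IHt] /=.
- exact: hvar.
- exact: h0.
- by rewrite -IHs -IHt -hD -free_piD.
- by rewrite -IHt -hZ -free_piZ.
- by rewrite -IHs -IHt -hlie -free_pi_lie.
Qed.

End Eval.
End FreeLie.

Lemma preimage_ideal_proof (K : fieldType) (L M : lieAlgType K) (f : L -> M)
    (fP : lie_morphism f) (I : lieIdeal M) :
  subspace (fun x => I (f x)) /\
  forall x y, I (f x) -> I (f (lie y x)).
Proof.
have [flin flie] := fP; have [I0 IL] := lieIdeal_subspace I.
have f0 : f 0 = 0 by have := flin (-1) 0 0; rewrite !scaleN1r !addNr.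
split; first split=> [|a u v Iu Iv] /=; rewrite ?f0 ?flin //; first exact: IL.
by move=> x y /=; rewrite flie; apply: lieIdeal_lie.
Qed.

Definition preimage_ideal (K : fieldType) (L M : lieAlgType K) (f : L -> M)
    (fP : lie_morphism f) (I : lieIdeal M) : lieIdeal L :=
  LieIdeal (preimage_ideal_proof fP I).1 (preimage_ideal_proof fP I).2.

Record lieGrading (K : fieldType) (G : zmodType) (L : lieAlgType K) := LieGrading {
  gcomp :> G -> set L ;
  gcomp_subspace : forall g, subspace (gcomp g) ;
  gcomp_lie : forall g h x y, gcomp g x -> gcomp h y -> gcomp (g + h) (lie x y) ;
  gcomp_sum : forall x, exists (s : seq G) (y : G -> L),
    (forall g, gcomp g (y g)) /\ x = \sum_(g <- s) y g ;
  gcomp_direct : forall (s : seq G) (y : G -> L), uniq s ->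
    (forall g, gcomp g (y g)) -> \sum_(g <- s) y g = 0 ->
    forall g, g \in s -> y g = 0
}.

Section RelativelyFree.
Context (K : fieldType) (G : zmodType) (L : lieAlgType K) (Gam : lieGrading G L).

Definition gsupport : set G := [set g | exists2 x, Gam g x & x <> 0].

(* The pair (g, i) stands for the variable x_i^g of degree g. The grading this
   induces on the free Lie algebra enters graded identities only through the
   degrees of the variables. *)
Definition gvar : Type := (G * nat)%type.

Definition graded_identities : set (freeLie K gvar) :=
  [set f | forall phi : gvar -> L, (forall v, Gam v.1 (phi v)) ->
             lie_eval phi f = 0].

Lemma graded_identities_ideal :
  subspace graded_identities /\
  forall f h, graded_identities f -> graded_identities (lie h f).
Proof.
split; first split=> [phi _|a f h If Ih phi phiG].
- have [elin _] := lie_eval_morphism phi.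
  by have := elin (-1) 0 0; rewrite !scaleN1r !addNr.
- have [elin _] := lie_eval_morphism phi.
  by rewrite elin If ?Ih // scaler0 addr0.
move=> f h If phi phiG; have [_ elie] := lie_eval_morphism phi.
by rewrite elie If // (lieD0 _).2.
Qed.

Definition TG : lieIdeal (freeLie K gvar) :=
  LieIdeal graded_identities_ideal.1 graded_identities_ideal.2.

(* k variables for each degree of the support. *)
Definition relvar (k : nat) : Type := (gsupport * 'I_k)%type.

Definition relvar_gvar k (v : relvar k) : gvar := (\val v.1, val v.2).

Definition rel_incl k : freeLie K (relvar k) -> freeLie K gvar :=
  lie_eval (fun v => free_var K (relvar_gvar v)).

Lemma rel_incl_morphism k : lie_morphism (@rel_incl k).
Proof. exact: lie_eval_morphism. Qed.

Lemma relvar_gvar_inj k : injective (@relvar_gvar k).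
Proof. by move=> [g i] [h j] [/val_inj -> /val_inj ->]. Qed.

Lemma rel_incl_inj k : injective (@rel_incl k).
Proof.
pose r (w : gvar) : freeLie K (relvar k) :=
  xget 0 [set t | exists2 v, relvar_gvar v = w & t = free_var K v].
have rE v : r (relvar_gvar v) = free_var K v.
  apply: xget_subset1; first by exists v.
  by move=> _ _ [a /relvar_gvar_inj -> ->] [b /relvar_gvar_inj -> ->].
have [rlin rlie] := lie_eval_morphism r.
have [ilin ilie] := rel_incl_morphism k.
apply: (can_inj (g := lie_eval r)) => f.
transitivity (lie_eval (@free_var K _) f); last first.
  by apply/esym; apply: (lie_eval_unique (h := id)).
apply: (lie_eval_unique (h := fun f => lie_eval r (rel_incl f))).
  by split=> [a x y|x y]; rewrite ?ilin ?rlin ?ilie ?rlie.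
by move=> v; rewrite /rel_incl !lie_eval_var rE.
Qed.

(* [rel_incl] identifies the free Lie algebra on the listed variables with a
   subalgebra of L(X); its intersection with T_G(L) is then a preimage. *)
Definition relfree (k : nat) : lieAlgType K :=
  idealQuot (preimage_ideal (rel_incl_morphism k) TG).

End RelativelyFree.

Section Growth.
Context (K : fieldType) (A : lieAlgType K).

(* [lie_word V m x]: x is the value of a (bracketed) word of length m in V. *)
Inductive lie_word (V : set A) : nat -> A -> Prop :=
| word_gen v : V v -> lie_word V 1 v
| word_lie i j x y : lie_word V i x -> lie_word V j y -> lie_word V (i + j)%N (lie x y).

Definition growth (V : set A) (m : nat) : nat :=
  dimension (lspan [set x | exists2 i, (i <= m)%N & lie_word V i x]).

Definition generates (V : set A) : Prop :=
  forall B : set A, subspace B -> (forall x y, B x -> B y -> B (lie x y)) ->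
    V `<=` B -> B = setT.

Definition growth_exponent (R : realType) (V : set A) : \bar R :=
  limn_esup (fun m => (ln (growth V m)%:R / ln m%:R)%:E).

(* A is finitely generated and its Gelfand-Kirillov dimension is d. The growth
   exponent does not depend on the finite generating set, so d is required to be
   its value for all of them. *)
Definition has_GKdim (R : realType) (d : \bar R) : Prop :=
  (exists2 V : set A, finite_set V & generates V) /\
  forall V : set A, finite_set V -> generates V -> growth_exponent R V = d.

End Growth.

Definition has_graded_GKdim (R : realType) (K : fieldType) (G : zmodType)
    (L : lieAlgType K) (Gam : lieGrading G L) (k : nat) (d : \bar R) : Prop :=
  has_GKdim (relfree Gam k) d.

Section SL.
Context (K : fieldType) (n : nat).

Definition traceless : {pred 'M[K]_n} := [pred A | \tr A == 0].

Lemma traceless_submod : submod_closed traceless.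
Proof.
split=> [|a A B]; rewrite !inE ?mxtrace0 // => /eqP A0 /eqP B0.
by rewrite mxtraceD mxtraceZ A0 B0 mulr0 addr0.
Qed.
HB.instance Definition _ :=
  GRing.isSubmodClosed.Build K 'M[K]_n traceless traceless_submod.

Record sl := Sl { sl_mx :> 'M[K]_n ; sl_mxP : sl_mx \in traceless }.
HB.instance Definition _ := [isSub for sl_mx].
HB.instance Definition _ := [Choice of sl by <:].
HB.instance Definition _ := [SubChoice_isSubLmodule of sl by <:].

Lemma comm_traceless (A B : 'M[K]_n) : A *m B - B *m A \in traceless.
Proof. by rewrite inE mxtraceD linearN /= mxtrace_mulC subrr. Qed.

Definition sl_lie (A B : sl) : sl := Sl (comm_traceless A B).

Lemma sl_linl z : linear (sl_lie^~ z).
Proof.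
move=> a x y; apply: val_inj; rewrite !linearP /=.
rewrite mulmxDl mulmxDr -scalemxAl -scalemxAr scalerBr opprD.
by rewrite addrACA.
Qed.

Lemma sl_linr z : linear (sl_lie z).
Proof.
move=> a x y; apply: val_inj; rewrite !linearP /=.
rewrite mulmxDl mulmxDr -scalemxAl -scalemxAr scalerBr opprD.
by rewrite addrACA.
Qed.

Lemma sl_liexx x : sl_lie x x = 0.
Proof. by apply: val_inj; rewrite /= subrr. Qed.

Lemma sl_jacobi x y z :
  sl_lie x (sl_lie y z) + sl_lie y (sl_lie z x) + sl_lie z (sl_lie x y) = 0.
Proof.
apply: val_inj => /=; rewrite !mulmxBr !mulmxBl !mulmxA.
move: (x *m y *m z) (x *m z *m y) (y *m x *m z) (y *m z *m x) (z *m x *m y)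
  (z *m y *m x) => a b c d e f.
by apply/matrixP => i j; rewrite !mxE; ring.
Qed.

HB.instance Definition _ := isLieAlgebra.Build K sl sl_linl sl_linr sl_liexx sl_jacobi.

(* For n >= 2 the equation in 'Z_n says q - p = i mod n. *)
Definition vasilovsky_comp (i : 'Z_n) : set sl :=
  [set A | lspan [set E : 'M[K]_n | exists p q : 'I_n,
                    (q%:R - p%:R = i :> 'Z_n) /\ E = delta_mx p q] (sl_mx A)].

Lemma vasilovsky_compP (i : 'Z_n) (A : sl) :
  vasilovsky_comp i A <->
  forall p q : 'I_n, q%:R - p%:R != i :> 'Z_n -> sl_mx A p q = 0.
Proof.
split=> [[s [sP ->]] p q pq|AP].
  rewrite summxE big_seq big1 // => -[c E] /sP /= [p' [q' [pq' ->]]].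
  rewrite !mxE; case: eqP => [pp|_]; last by rewrite mulr0.
  case: eqP => [qq|_]; last by rewrite mulr0.
  by move: pq; rewrite pp qq pq' eqxx.
pose P := [pred x : 'I_n * 'I_n | x.2%:R - x.1%:R == i :> 'Z_n].
exists [seq (sl_mx A x.1 x.2, delta_mx x.1 x.2) | x <- enum P]; split.
  move=> _ /mapP[[p q] + ->] /=; rewrite mem_enum => /eqP pq.
  by exists p, q.
rewrite big_map big_enum /= [LHS]matrix_sum_delta pair_big /=.
rewrite (bigID P) /= [X in _ + X]big1 ?addr0 // => -[p q] /= pq.
by rewrite AP // scale0r.
Qed.

Lemma vasilovsky_subspace i : subspace (vasilovsky_comp i).
Proof.
split=> [|a u v /vasilovsky_compP uP /vasilovsky_compP vP]; apply/vasilovsky_compP.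
  by move=> p q _; rewrite mxE.
by move=> p q pq; rewrite !mxE uP // vP // mulr0 addr0.
Qed.

Lemma vasilovsky_lie i j x y :
  vasilovsky_comp i x -> vasilovsky_comp j y -> vasilovsky_comp (i + j) (lie x y).
Proof.
have H a b (u v : sl) (p q : 'I_n) : vasilovsky_comp a u -> vasilovsky_comp b v ->
    q%:R - p%:R != a + b :> 'Z_n -> (sl_mx u *m sl_mx v) p q = 0.
  move=> /vasilovsky_compP uP /vasilovsky_compP vP pq.
  rewrite mxE big1 // => r _.
  have [ra|ra] := eqVneq (r%:R - p%:R) a; last by rewrite uP ?mul0r.
  have [rb|rb] := eqVneq (q%:R - r%:R) b; last by rewrite vP ?mulr0.
  by move: pq; rewrite -ra -rb [X in _ != X]addrC addrA subrK eqxx.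
move=> ix jy; apply/vasilovsky_compP => p q pq /=.
have -> : sl_mx (lie x y) p q = (sl_mx x *m sl_mx y) p q - (sl_mx y *m sl_mx x) p q.
  by rewrite [LHS]mxE [X in _ + X]mxE.
have pq' : q%:R - p%:R != j + i :> 'Z_n by rewrite [j + i]addrC.
by rewrite (H i j x y p q ix jy pq) (H j i y x p q jy ix pq') subr0.
Qed.

Lemma vasilovsky_sum (x : sl) : exists (s : seq 'Z_n) (y : 'Z_n -> sl),
  (forall i, vasilovsky_comp i (y i)) /\ x = \sum_(i <- s) y i.
Proof.
pose M i := \matrix_(p, q < n)
  if q%:R - p%:R == i :> 'Z_n then sl_mx x p q else 0.
have MP i : M i \in traceless.
  rewrite inE /mxtrace; apply/eqP; have /eqP := sl_mxP x.
  have [->|i0] := eqVneq i 0 => xP; last first.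
    by apply: big1 => p _; rewrite mxE subrr eq_sym (negbTE i0).
  by rewrite -[RHS]xP; apply: eq_bigr => p _; rewrite mxE subrr eqxx.
exists (index_enum 'Z_n), (fun i => Sl (MP i)); split=> [i|].
  by apply/vasilovsky_compP => p q /negbTE pq; rewrite mxE pq.
apply: val_inj; rewrite raddf_sum /=; apply/matrixP => p q.
rewrite summxE (bigD1 (q%:R - p%:R)) //= mxE eqxx big1 ?addr0 // => i ipq.
by rewrite mxE eq_sym (negbTE ipq).
Qed.

Lemma vasilovsky_direct (s : seq 'Z_n) (y : 'Z_n -> sl) : uniq s ->
  (forall i, vasilovsky_comp i (y i)) -> \sum_(i <- s) y i = 0 ->
  forall i, i \in s -> y i = 0.
Proof.
move=> us yP ys0 i si; apply: val_inj; apply/matrixP => p q /=.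
rewrite [RHS]mxE; have [pq|pq] := eqVneq (q%:R - p%:R) i; last first.
  by have /vasilovsky_compP -> := yP i.
have : (val (\sum_(j <- s) y j) : 'M[K]_n) p q = 0 by rewrite ys0 mxE.
rewrite raddf_sum summxE (bigD1_seq i) //= big1 ?addr0 // => j ji.
by have /vasilovsky_compP -> := yP j; rewrite ?pq 1?eq_sym.
Qed.

Definition vasilovsky : lieGrading 'Z_n sl :=
  LieGrading vasilovsky_subspace vasilovsky_lie vasilovsky_sum vasilovsky_direct.

End SL.

(* Main.v *)
Require Import Defs.
From mathcomp Require Import all_boot all_order all_algebra.
From mathcomp Require Import all_classical all_reals all_analysis.
From mathcomp Require Import ring lra zify.

Set Implicit Arguments.
Unset Strict Implicit.
Unset Printing Implicit Defensive.

Import Order.TTheory GRing.Theory Num.Theory.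

Local Open Scope classical_set_scope.
Local Open Scope ring_scope.

(** A graded substitution is a point of an affine space with one coordinate for
    each entry of each of the [k] generic elements of every degree, subject to
    the vanishing of the [k] traces in degree zero; this space has dimension
    [k (n^2 - 1)]. An element of the relatively free algebra is the same thing as
    the matrix-valued polynomial function that it defines there. The diagonal
    torus acts by conjugation and preserves the grading, and a generic orbit
    meets exactly once the slice on which the superdiagonal of the first generic
    element of degree one consists of ones. The slice has
    [t = k (n^2 - 1) - (n - 1)] coordinates, and it remains to see that the
    algebra grows like all polynomial functions of [t] variables.

    Upper bound. Functions that come from the algebra are equivariant, so they
    are determined by their restriction to the slice ([at_gauge_inj]). A word of
    length [l] in finitely many elements restricts to a matrix of polynomials
    whose degree in each coordinate is linear in [l], which leaves room for
    [O (l^t)] independent words ([growth_bounds]).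

    Lower bound. Elements [h] of degree zero are diagonal, so [ad h] multiplies
    the [(0, 1)] entry by the difference [f h] of the first two diagonal entries
    of [h]. Products of such operators applied to one element realise every
    monomial in the functions [f h]; hence [t] algebraically independent ones
    among these functions give growth of order [l^t]. In characteristic zero it
    suffices that their Jacobian is invertible at one point
    ([power_products_indep]), that is, that a tangent vector [y] of the slice
    which kills all the [f h] is zero ([direction_eq0]).

    This is tested at a point where the off-diagonal entries are ones and the
    diagonal element [D] of degree zero has distinct differences of entries. The
    derivative of [f] at [[(ad D)^a s, s']] is an exponential polynomial in [a]
    with these differences as nodes, so the contribution of each matrix position
    vanishes separately ([tangent_separation]). First this shows that all
    elements of degree zero have derivative zero, then that for every pair of
    positions [(p, q)] and [(q, p)] the product of the entries there of two
    elements of opposite degrees is stationary. The normalised superdiagonal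
    entries are stationary by construction; commutators carry this to all
    positions above the diagonal, and the products carry it below. *)

(** * Linear algebra: dimension through independent families *)

Section LinearAlgebra.
Context (K : fieldType) (V : lmodType K).
Implicit Types (W : set V).

Definition indep (I : finType) (b : I -> V) : Prop :=
  forall c : I -> K, \sum_i c i *: b i = 0 -> forall i, c i = 0.

Lemma left_kernel_nontrivial r d (C : 'M[K]_(r, d)) :
  (d < r)%N -> exists2 u : 'rV[K]_r, u != 0 & u *m C = 0.
Proof.
move=> dr; have : kermx C != 0.
  by rewrite kermx_eq0 /row_free neq_ltn (leq_ltn_trans (rank_leq_col C) dr).
case/rowV0Pn => u /sub_kermxP uC u0.
by exists u.
Qed.

Lemma indep_leq (I J : finType) (b : I -> V) (g : J -> V) :
  indep b -> (forall i, exists c : J -> K, b i = \sum_j c j *: g j) ->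
  (#|I| <= #|J|)%N.
Proof.
move=> bI /choice[c bE]; rewrite leqNgt; apply/negP => JI.
pose C := \matrix_(i < #|I|, j < #|J|) c (enum_val i) (enum_val j).
have [u u0 uC] := left_kernel_nontrivial C JI.
case/rV0Pn: u0 => i0; apply/negP; rewrite negbK; apply/eqP.
rewrite -(enum_valK i0); apply: (bI (fun i => u 0 (enum_rank i))).
under eq_bigr => i _ do rewrite bE scaler_sumr.
rewrite exchange_big big1 // => j _.
under eq_bigr => i _ do rewrite scalerA.
rewrite -scaler_suml (_ : \sum_i _ = (u *m C) 0 (enum_rank j)).
  by rewrite uC mxE scale0r.
rewrite mxE (reindex _ (onW_bij _ (enum_val_bij I))) /=.
by apply: eq_bigr => i _; rewrite mxE !enum_rankK enum_valK.
Qed.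

Lemma lspan_subspace (S : set V) : Defs.subspace (lspan S).
Proof.
split; first by exists [::]; rewrite big_nil.
move=> a _ _ [s [sS ->]] [t [tS ->]].
exists ([seq (a * p.1, p.2) | p <- s] ++ t); split=> [p|].
  by rewrite mem_cat => /orP[/mapP[q /sS qS ->]|/tS].
rewrite big_cat big_map /= scaler_sumr; congr (_ + _).
by apply: eq_bigr => p _; rewrite scalerA.
Qed.

Lemma sub_lspan (S : set V) v : S v -> lspan S v.
Proof.
by exists [:: (1, v)]; split=> [p|]; rewrite ?inE ?big_seq1 ?scale1r // => /eqP ->.
Qed.

Lemma subspaceZ W a v : Defs.subspace W -> W v -> W (a *: v).
Proof. by move=> [W0 WP] /(WP a v 0) /(_ W0); rewrite addr0. Qed.

Lemma subspaceD W u v : Defs.subspace W -> W u -> W v -> W (u + v).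
Proof. by move=> [_ WP] /(WP 1 u v) + /[dup] => /[apply]; rewrite scale1r. Qed.

Lemma subspace_sum W (T : eqType) (s : seq T) (F : T -> V) :
  Defs.subspace W -> (forall i, i \in s -> W (F i)) -> W (\sum_(i <- s) F i).
Proof.
move=> WP; elim: s => [|i s IHs] sP; first by rewrite big_nil; case: WP.
rewrite big_cons; apply: subspaceD => //; first exact/sP/mem_head.
by apply: IHs => j js; apply: sP; rewrite inE js orbT.
Qed.

Lemma lspan_min (S : set V) W : Defs.subspace W -> S `<=` W -> lspan S `<=` W.
Proof.
move=> WP SW _ [s [sS ->]]; apply: subspace_sum => // p /sS /SW.
exact: subspaceZ.
Qed.

Lemma lspan_tupleP d (b : d.-tuple V) v :
  lspan [set` b] v <-> exists c : 'I_d -> K, v = \sum_i c i *: tnth b i.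
Proof.
split=> [|[c ->]]; last first.
  apply: subspace_sum => [|i _]; first exact: lspan_subspace.
  by apply: subspaceZ; [exact: lspan_subspace|apply/sub_lspan/mem_tnth].
move: v; apply: lspan_min.
  split; first by exists (fun=> 0); rewrite big1 // => i _; rewrite scale0r.
  move=> a _ _ [c ->] [c' ->]; exists (fun i => a * c i + c' i).
  rewrite scaler_sumr -big_split; apply: eq_bigr => i _ /=.
  by rewrite scalerDl scalerA.
move=> v /tnthP[i ->]; exists (fun j => (j == i)%:R).
rewrite (bigD1 i) //= eqxx scale1r big1 ?addr0 // => j /negbTE ->.
by rewrite scale0r.
Qed.

(** A family that cannot be lengthened inside [W] spans [W]; hence a bound on
    the length of independent families produces a basis. *)
Lemma basis_exists W B : Defs.subspace W ->
  (forall r (b : 'I_r -> V), indep b -> (forall i, W (b i)) -> (r <= B)%N) ->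
  exists d (b : d.-tuple V), is_basis W b.
Proof.
move=> WP WB.
pose P r := `[< exists2 b : r.-tuple V, indep (tnth b) & forall i, W (tnth b i) >].
have P0 : exists r, P r.
  by exists 0%N; apply/asboolP; exists [tuple] => [c _|] [].
have PB r : P r -> (r <= B)%N.
  by move=> /asboolP[b bI bW]; apply: (WB r (tnth b)).
have [r /asboolP[b bI bW] rmax] := ex_maxnP P0 PB.
exists r, b; split=> //; apply/seteqP; split.
  by apply: lspan_min => // v /tnthP[i ->].
move=> v Wv; apply: contrapT => vb.
suff /rmax : P r.+1 by rewrite ltnn.
apply/asboolP; exists [tuple of v :: b]; last first.
  by move=> i; case: (unliftP ord0 i) => [j|] ->; rewrite ?tnth0 // tnthS.
move=> c; rewrite big_ord_recl tnth0; under eq_bigr do rewrite tnthS.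
move=> c0; have cE : c ord0 = 0.
  apply: contrapT => /eqP cN; apply: vb; apply/lspan_tupleP.
  exists (fun i => - (c ord0)^-1 * c (lift ord0 i)).
  apply: (scalerI cN); move/eqP: c0; rewrite addr_eq0 => /eqP ->.
  rewrite scaler_sumr -sumrN; apply: eq_bigr => i _.
  by rewrite scalerA mulrA mulrN divff // mulN1r scaleNr.
move: c0; rewrite cE scale0r add0r => /(bI (fun i => c (lift ord0 i))) ci.
by move=> i; case: (unliftP ord0 i) => [j|] ->.
Qed.

Lemma dimension_bounds W B : Defs.subspace W ->
  (forall r (b : 'I_r -> V), indep b -> (forall i, W (b i)) -> (r <= B)%N) ->
  (dimension W <= B)%N /\
  forall (I : finType) (b : I -> V), indep b -> (forall i, W (b i)) ->
    (#|I| <= dimension W)%N.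
Proof.
move=> WP WB; have [d0 [b0 b0W]] := basis_exists WP WB.
have : [set d | exists b : d.-tuple V, is_basis W b] (dimension W).
  by apply: (@xgetPex _ 0%N); exists d0, b0.
move: (dimension W) => d [b [bI bE]].
have bW v : W v <-> exists c, v = \sum_i c i *: tnth b i.
  by rewrite -bE; apply: lspan_tupleP.
split; last first.
  move=> I g gI gW; rewrite -[X in (_ <= X)%N]card_ord.
  by apply: indep_leq gI _ => i; apply/bW/gW.
apply: (WB _ (tnth b)) => // i; rewrite -bE; exact/sub_lspan/mem_tnth.
Qed.

End LinearAlgebra.

(** Linear forms without a common zero contain a coordinate system. *)
Lemma unitmx_of_forms (K : fieldType) (t : nat) (S : set 'cV[K]_t) :
  (forall v : 'rV[K]_t, (forall u, S u -> v *m u = 0) -> v = 0) ->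
  exists2 M : 'M[K]_t, M \in unitmx & forall j, S (col j M).
Proof.
move=> SP.
suff H r : (r <= t)%N ->
    exists2 M : 'M[K]_(t, r), \rank M = r & forall j, S (col j M).
  have [M Mr MS] := H t (leqnn t).
  by exists M => //; rewrite -row_full_unit /row_full Mr.
elim: r => [|r IHr] rt.
  by exists 0; [rewrite mxrank0|case].
have [M Mr MS] := IHr (ltnW rt).
have [v v0 vM] := left_kernel_nontrivial M rt.
have [u Su vu] : exists2 u, S u & v *m u != 0.
  apply: contrapT => Hn; move/negP: v0; apply; apply/eqP/SP => u Su.
  by apply: contrapT => /eqP vu; apply: Hn; exists u.
have rE : (r + 1)%N = r.+1 by rewrite addn1.
exists (castmx (erefl, rE) (row_mx M u)); last first.
  move=> j; rewrite -(cast_ordKV rE j); set i := cast_ord _ j.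
  have -> : col (cast_ord rE i) (castmx (erefl, rE) (row_mx M u)) =
            col i (row_mx M u).
    by apply/matrixP => a b; rewrite [LHS]mxE castmxE [RHS]mxE /= cast_ord_id cast_ordK.
  by case: (split_ordP i) => l ->; rewrite ?colKl ?colKr //; rewrite col_id.
rewrite (_ : \rank _ = \rank (row_mx M u)); last by case: _ / rE.
apply/eqP; rewrite -mxrank_tr tr_row_mx eqn_leq -[X in (_ <= X)%N]rE rank_leq_row /=.
rewrite -{1}Mr -mxrank_tr ltn_neqAle.
have sub : (M^T <= col_mx M^T u^T)%MS by rewrite -addsmxE addsmxSl.
rewrite mxrankS // andbT; apply/negP => /eqP rk.
have /submxP[D uD] : (u^T <= M^T)%MS.
  apply: submx_trans (_ : col_mx M^T u^T <= _)%MS.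
    by rewrite -addsmxE addsmxSr.
  by move: (mxrank_leqif_sup sub) => [_]; rewrite rk eqxx => <-.
move: vu; rewrite -[u]trmxK uD trmx_mul trmxK mulmxA vM mul0mx eqxx.
by [].
Qed.

(** * Polynomials and exponential sums in characteristic zero *)

Section CharZero.
Context (K : fieldType) (charK : [pchar K] =i pred0).

Lemma char0_natr_eq0 (m : nat) : (m%:R == 0 :> K) = (m == 0%N).
Proof. exact: (pcharf0P K).1 charK m. Qed.

Lemma char0_natr_inj : injective (fun m : nat => m%:R : K).
Proof.
move=> a b; wlog ab : a b / (a <= b)%N => [H|].
  by case: (leqP a b) => [/H|/ltnW /H h] // /esym /h.
move=> /esym /eqP; rewrite -subr_eq0 -natrB // char0_natr_eq0 subn_eq0 => ba.
by apply/eqP; rewrite eqn_leq ab.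
Qed.

Lemma poly_eq0_horner (p : {poly K}) : (forall s, p.[s] = 0) -> p = 0.
Proof.
move=> p0; apply: (@roots_geq_poly_eq0 _ _ [seq i%:R | i <- iota 0 (size p)]).
- by apply/allP => x _; apply/eqP.
- by rewrite (map_inj_uniq char0_natr_inj) iota_uniq.
- by rewrite size_map size_iota.
Qed.

(** The condition says that the functional [P |-> sum b s P(l s) + c s P'(l s)]
    kills every polynomial; polynomials vanishing to order two at all nodes but
    one isolate the coefficients at that node. *)
Lemma exp_sum_indep (I : finType) (A : {pred I}) (b c l : I -> K) :
  {in A &, injective l} ->
  (forall a : nat, \sum_(i in A) (b i * l i ^+ a + c i * (l i ^+ a.-1 *+ a)) = 0) ->
  {in A, forall i, b i = 0 /\ c i = 0}.
Proof.
move=> linj bc0 i iA.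
have bcP (P : {poly K}) :
    \sum_(i in A) (b i * P.[l i] + c i * P^`().[l i]) = 0.
  rewrite -(coefK P) poly_def raddf_sum /=.
  under eq_bigr => j _ do rewrite !horner_sum !mulr_sumr -big_split /=.
  rewrite exchange_big big1 //= => a _.
  transitivity (P`_a *
      \sum_(j in A) (b j * l j ^+ a + c j * (l j ^+ a.-1 *+ a))); last first.
    by rewrite bc0 mulr0.
  rewrite mulr_sumr; apply: eq_bigr => j _.
  rewrite derivZ derivXn !hornerE hornerMn !hornerE /=.
  by ring.
pose Q := \prod_(j in A | j != i) ('X - (l j)%:P).
have Qi : Q.[l i] != 0.
  rewrite horner_prod prodf_seq_neq0; apply/allP => j _.
  apply/implyP => /andP[jA ji]; rewrite !hornerE subr_eq0.
  by apply: contra ji => /eqP /linj ->.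
have Qj j : j \in A -> j != i -> Q.[l j] = 0.
  move=> jA ji; rewrite horner_prod (bigD1 j) ?jA //= !hornerE subrr.
  by rewrite !mul0r.
(* At [l i] the test polynomial vanishes, but its derivative does not. *)
have ci : c i = 0.
  have := bcP (Q ^+ 2 * ('X - (l i)%:P)).
  rewrite (bigD1 i) //= big1 ?addr0; last first.
    move=> j /andP[jA ji]; rewrite !poly.derivE !hornerE Qj //.
    by rewrite /=; ring.
  rewrite !poly.derivE !hornerE subrr => H.
  have /eqP : c i * Q.[l i] ^+ 2 = 0 by rewrite -[RHS]H /=; ring.
  by rewrite mulf_eq0 expf_eq0 (negbTE Qi) /= orbF => /eqP.
split=> //; have := bcP (Q ^+ 2).
rewrite (bigD1 i) //= big1 ?addr0; last first.
  move=> j /andP[jA ji]; rewrite !poly.derivE !hornerE Qj //.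
  by rewrite /=; ring.
move=> H; have /eqP : b i * Q.[l i] ^+ 2 = 0.
  by rewrite -[RHS]H ci mul0r addr0 horner_exp.
by rewrite mulf_eq0 expf_eq0 (negbTE Qi) /= orbF => /eqP.
Qed.

Lemma digits_inj m t (a b : 'I_t -> 'I_m) :
  (\sum_(j < t) a j * m ^ j = \sum_(j < t) b j * m ^ j)%N -> a =1 b.
Proof.
elim: t a b => [|t IHt] a b; first by move=> _ [].
rewrite !big_ord_recl /= !expn0 !muln1.
have E (c : 'I_t.+1 -> 'I_m) : (\sum_(i < t) c (lift ord0 i) * m ^ bump 0 i =
    (\sum_(i < t) c (lift ord0 i) * m ^ i) * m)%N.
  by rewrite big_distrl; apply: eq_bigr => i _; rewrite /bump expnSr mulnA.
rewrite !E => ab.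
have m0 : (0 < m)%N by apply: leq_trans (ltn_ord (a ord0)).
have ab0 : (a ord0 = b ord0 :> nat).
  by have := congr1 (modn^~ m) ab; rewrite ![(_ + _ * m)%N]addnC !modnMDl !modn_small.
move/eqP: ab; rewrite ab0 eqn_add2l eqn_pmul2r // => /eqP /IHt abS j.
by case: (unliftP ord0 j) => [i|] ->; [apply: abS|apply: val_inj].
Qed.

(** Kronecker substitution: on the curve [z j = u ^ (m ^ j)] distinct monomials
    of degree less than [m] in each variable become distinct powers of [u]. *)
Lemma monomials_indep m t (c : {ffun 'I_t -> 'I_m} -> K) :
  (forall z : 'I_t -> K, \sum_a c a * \prod_j z j ^+ a j = 0) ->
  forall a, c a = 0.
Proof.
move=> c0 a0.
pose N (a : {ffun 'I_t -> 'I_m}) := (\sum_(j < t) a j * m ^ j)%N.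
have N_inj : injective N by move=> a b /digits_inj ab; apply/ffunP.
pose p := \sum_a (c a)%:P * 'X^(N a) : {poly K}.
have p0 : p = 0.
  apply: poly_eq0_horner => u; rewrite -[RHS](c0 (fun j => u ^+ (m ^ j)%N)).
  rewrite horner_sum; apply: eq_bigr => a _; rewrite !hornerE; congr (_ * _).
  rewrite expr_sum; apply: eq_bigr => j _.
  by rewrite -exprM mulnC.
have := congr1 (fun q : {poly K} => q`_(N a0)) p0.
rewrite coef0 coef_sum (bigD1 a0) //= coefCM coefXn eqxx mulr1 big1 ?addr0 //.
by move=> a aa; rewrite coefCM coefXn (inj_eq N_inj) eq_sym (negbTE aa) mulr0.
Qed.

(** Functions vanishing at the origin with invertible Jacobian there are
    algebraically independent: along each line through the origin the terms of
    lowest order of a relation form a relation between the linear parts. *)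
Lemma power_products_indep m t (M : 'M[K]_t) (P : 'rV[K]_t -> 'I_t -> {poly K})
    (c : {ffun 'I_t -> 'I_m} -> K) :
  M \in unitmx -> (forall y j, (P y j)`_0 = 0) ->
  (forall y j, (P y j)`_1 = (y *m M) 0 j) ->
  (forall y s, \sum_a c a * \prod_j (P y j).[s] ^+ a j = 0) ->
  forall a, c a = 0.
Proof.
move=> Mu P0 P1 c0; apply: contrapT => /existsNP[a1 /eqP ca1].
pose deg (a : {ffun 'I_t -> 'I_m}) := (\sum_j a j)%N.
have [a0 ca0 a0min] := @arg_minnP _ a1 (fun a => c a != 0) deg ca1.
pose c' a := if deg a == deg a0 then c a else 0.
suff /monomials_indep/(_ a0) : forall z : 'I_t -> K,
    \sum_a c' a * \prod_j z j ^+ a j = 0.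
  by rewrite /c' eqxx => /eqP; rewrite (negbTE ca0).
(* The line is chosen so that the linear parts take the prescribed values. *)
move=> z; pose y := (\row_j z j) *m invmx M.
have yz j : (y *m M) 0 j = z j by rewrite mulmxKV // mxE.
pose Q j := drop_poly 1 (P y j).
have PQ j : P y j = Q j * 'X.
  rewrite -[LHS](poly_take_drop 1) [X in X + _](_ : _ = 0) ?add0r ?expr1 //.
  by apply/polyP => i; rewrite coef_take_poly coef0; case: i => [|i] //=.
have Q0 j : (Q j).[0] = z j.
  by rewrite horner_coef0 coef_drop_poly P1 yz.
pose S := \sum_a (c a)%:P * ('X ^+ (deg a - deg a0) * \prod_j Q j ^+ a j).
have S0 : S = 0.
  suff : S * 'X ^+ deg a0 = 0.
    by move/eqP; rewrite mulf_eq0 expf_eq0 polyX_eq0 andbF orbF => /eqP.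
  apply: poly_eq0_horner => s; rewrite -[RHS](c0 y s) hornerM horner_sum.
  rewrite mulr_suml; apply: eq_bigr => a _.
  rewrite !(hornerM, hornerC, hornerXn).
  have [->|ca] := eqVneq (c a) 0; first by rewrite !mul0r.
  rewrite -mulrA; congr (_ * _); rewrite horner_prod mulrAC -exprD subnK ?a0min //.
  rewrite /deg expr_sum -big_split /=; apply: eq_bigr => j _.
  by rewrite PQ hornerM hornerX horner_exp exprMn mulrC.
rewrite -[RHS](horner0 0) -S0 horner_sum; apply: eq_bigr => a _.
rewrite /c' hornerM hornerM hornerC hornerXn horner_prod.
under [in RHS]eq_bigr do rewrite horner_exp Q0.
have [aa|aa] := eqVneq (deg a) (deg a0); first by rewrite aa subnn mul1r.
have [->|ca] := eqVneq (c a) 0; first by rewrite !mul0r.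
have lt : (deg a0 < deg a)%N by rewrite ltn_neqAle eq_sym aa a0min.
by rewrite expr0n subn_eq0 leqNgt lt /= mul0r mulr0.
Qed.

End CharZero.

Lemma expn2_sum_inj a b c e :
  (2 ^ a + 2 ^ b = 2 ^ c + 2 ^ e)%N -> (a = c /\ b = e) \/ (a = e /\ b = c).
Proof.
have pos x : (0 < 2 ^ x)%N by rewrite expn_gt0.
elim: a b c e => [|a IHa] [|b] [|c] [|e]; rewrite ?expnS ?expn0 => H;
  try (move: (pos a) (pos b) (pos c) (pos e); lia);
  try (move: (pos a) (pos b); lia); try (move: (pos c) (pos e); lia);
  try lia.
- by have -> : b = e by [apply: (@expnI 2) => //; lia]; tauto.
- by have -> : b = c by [apply: (@expnI 2) => //; lia]; tauto.
- by have -> : a = e by [apply: (@expnI 2) => //; lia]; tauto.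
- by have -> : a = c by [apply: (@expnI 2) => //; lia]; tauto.
- by have /IHa : (2 ^ a + 2 ^ b = 2 ^ c + 2 ^ e)%N; [lia|case=> -[-> ->]; tauto].
Qed.

(** * Evaluating Lie polynomials at matrices over commutative rings *)

Section MatrixEvaluation.
Context (K : fieldType) (X : Type) (n : nat).

(** Coefficients live in an arbitrary commutative ring: besides [K] itself, the
    ring [{poly K}] evaluates along a whole line at once. *)
Fixpoint meval (S : comNzRingType) (c : K -> S) (psi : X -> 'M[S]_n)
    (t : lieTerm K X) : 'M[S]_n :=
  match t with
  | TVar x => psi x
  | TZero => 0
  | TAdd s t => meval c psi s + meval c psi t
  | TScale a t => c a *: meval c psi t
  | TLie s t => meval c psi s *m meval c psi t - meval c psi t *m meval c psi s
  end.

Lemma eq_meval (S : comNzRingType) (c : K -> S) (psi psi' : X -> 'M[S]_n) t :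
  psi =1 psi' -> meval c psi t = meval c psi' t.
Proof. by move=> E; elim: t => //= [s -> t ->|a t ->|s -> t ->]. Qed.

Lemma map_meval (S S' : comNzRingType) (f : {rmorphism S -> S'}) c psi t :
  map_mx f (meval c psi t) = meval (f \o c) (fun v => map_mx f (psi v)) t.
Proof.
elim: t => //= [|s IHs t IHt|a t IHt|s IHs t IHt].
- exact: map_mx0.
- by rewrite map_mxD IHs IHt.
- by rewrite map_mxZ IHt.
- by rewrite map_mxB !map_mxM IHs IHt.
Qed.

(** Torus equivariance is the case of a diagonal [D]. *)
Lemma meval_conj (S : comNzRingType) (c : K -> S) (psi : X -> 'M[S]_n)
    (D D' : 'M[S]_n) t : D' *m D = 1%:M ->
  meval c (fun v => D *m psi v *m D') t = D *m meval c psi t *m D'.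
Proof.
move=> DD; have conjM (A B : 'M[S]_n) :
    D *m A *m D' *m (D *m B *m D') = D *m (A *m B) *m D'.
  by rewrite !mulmxA -[_ *m D' *m D]mulmxA DD mulmx1.
elim: t => //= [|s -> t ->|a t ->|s -> t ->].
- by rewrite mulmx0 mul0mx.
- by rewrite mulmxDr mulmxDl.
- by rewrite -scalemxAr -scalemxAl.
- by rewrite !conjM mulmxBr mulmxBl.
Qed.

Lemma meval_sl (gen_sl : X -> sl K n) t :
  sl_mx (term_eval gen_sl t) = meval idfun (fun v => sl_mx (gen_sl v)) t.
Proof.
elim: t => //= [s IHs t IHt|a t IHt|s IHs t IHt].
- by rewrite -IHs -IHt.
- by rewrite -IHt.
- by rewrite -IHs -IHt.
Qed.

End MatrixEvaluation.

Section GenericElements.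
Context (K : fieldType) (m k' : nat).
Local Notation n := m.+3.
Local Notation k := k'.+1.
Local Notation Gam := (vasilovsky K n).
Local Notation X := (relvar Gam k).

(** The degree of the matrix unit [e_pq]. *)
Definition unit_deg (p q : 'I_n) : 'Z_n := q%:R - p%:R.

Lemma ord_Zp_inj (p q : 'I_n) : p%:R = q%:R :> 'Z_n -> p = q.
Proof. by rewrite !natr_Zp. Qed.

Lemma unit_degpp p : unit_deg p p = 0. Proof. exact: subrr. Qed.

Lemma unit_deg_eq0 p q : (unit_deg p q == 0) = (p == q).
Proof.
by apply/eqP/eqP => [/subr0_eq/ord_Zp_inj ->|->]; rewrite ?unit_degpp.
Qed.

Lemma unit_degD p q r : unit_deg p q + unit_deg q r = unit_deg p r.
Proof. by rewrite /unit_deg addrC addrA subrK. Qed.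

Lemma unit_deg_inj p : injective (unit_deg p).
Proof. by move=> q r /addIr/ord_Zp_inj. Qed.

Lemma unit_deg_nat (p q : 'I_n) l : q = (p + l)%N :> nat -> unit_deg p q = l%:R.
Proof. by rewrite /unit_deg => ->; rewrite natrD addrC addKr. Qed.

Lemma support_full (g : 'Z_n) : gsupport Gam g.
Proof.
have tr1 (q : 'I_n) : \tr (delta_mx q q : 'M[K]_n) = 1.
  rewrite /mxtrace (bigD1 q) //= mxE !eqxx big1 ?addr0 // => i /negbTE iq.
  by rewrite mxE iq.
have [->|g0] := eqVneq g 0.
  pose A : 'M[K]_n := delta_mx ord0 ord0 - delta_mx ord_max ord_max.
  have At : A \in traceless (K := K) (n := n) by rewrite inE linearB /= !tr1 subrr.
  exists (Sl At).
    apply/vasilovsky_compP => p q /= pq; rewrite !mxE.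
    have {}pq : p != q by rewrite -unit_deg_eq0.
    have d0 (r : 'I_n) : (p == r) && (q == r) = false.
      by apply: contraNF pq => /andP[/eqP -> /eqP ->].
    by rewrite !d0 subrr.
  move=> /(congr1 (fun B : sl K n => sl_mx B ord0 ord0)) /eqP.
  by rewrite /= !mxE /= subr0 oner_eq0.
pose q : 'I_n := g.
have q0 : q != ord0 by [].
pose A : 'M[K]_n := delta_mx ord0 q.
have At : A \in traceless (K := K) (n := n).
  rewrite inE /mxtrace big1 // => p _; rewrite !mxE.
  by case: eqP => // -> /=; rewrite eq_sym (negbTE q0).
exists (Sl At).
  apply/vasilovsky_compP => r s /= rs; rewrite !mxE.
  case: eqP => //= r0; case: eqP => //= sq; move: rs.
  by rewrite r0 sq /= subr0 natr_Zp eqxx.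
move=> /(congr1 (fun B : sl K n => sl_mx B ord0 q)) /eqP.
by rewrite /= !mxE !eqxx oner_eq0.
Qed.

Definition gen_var (g : 'Z_n) (i : 'I_k) : X :=
  (SigSub (mem_set (support_full g)), i).

Lemma gen_varK (v : X) : gen_var (\val v.1) v.2 = v.
Proof. by case: v => g i; congr pair; apply: val_inj. Qed.

(** The entry [x (i, p, q)] is the coefficient of [e_pq] in the [i]-th generic
    element of degree [q - p], so each matrix position lies in one component. *)
Definition idx : Type := ('I_k * 'I_n * 'I_n)%type.

Definition gen (S : comNzRingType) (x : idx -> S) (v : X) : 'M[S]_n :=
  \matrix_(p, q) if unit_deg p q == \val v.1 then x (v.2, p, q) else 0.

Definition trace_free (S : comNzRingType) (x : idx -> S) : Prop :=
  forall i, \sum_p x (i, p, p) = 0.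

Lemma map_gen (S S' : comNzRingType) (f : {rmorphism S -> S'}) x v :
  map_mx f (gen x v) = gen (f \o x) v.
Proof. by apply/matrixP => p q; rewrite !mxE; case: ifP; rewrite ?rmorph0. Qed.

Lemma trace_gen (S : comNzRingType) (x : idx -> S) v : trace_free x -> \tr (gen x v) = 0.
Proof.
move=> x0; rewrite /mxtrace; have [v0|v0] := eqVneq (\val v.1 : 'Z_n) 0.
  rewrite -[RHS](x0 v.2); apply: eq_bigr => p _.
  by rewrite mxE unit_degpp v0 eqxx.
by apply: big1 => p _; rewrite mxE unit_degpp eq_sym (negbTE v0).
Qed.

(** The default value [0] is taken only when some trace does not vanish. *)
Definition gen_sl (x : idx -> K) (v : X) : sl K n := insubd (0 : sl K n) (gen x v).

Lemma gen_slE x v : trace_free x -> sl_mx (gen_sl x v) = gen x v.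
Proof. by move=> x0; apply: insubdK; rewrite inE trace_gen. Qed.

Lemma gen_sl_graded x v : trace_free x -> Gam (\val v.1) (gen_sl x v).
Proof.
move=> x0; apply/vasilovsky_compP => p q pq; rewrite gen_slE // mxE.
by rewrite (negbTE pq : unit_deg p q == _ = false).
Qed.

Lemma graded_gen_sl (f : X -> sl K n) : (forall v, Gam (\val v.1) (f v)) ->
  exists2 x, trace_free x & f =1 gen_sl x.
Proof.
move=> fG; pose x (u : idx) := sl_mx (f (gen_var (unit_deg u.1.2 u.2) u.1.1)) u.1.2 u.2.
have x0 : trace_free x.
  move=> i; rewrite /x /=; under eq_bigr do rewrite unit_degpp.
  exact/eqP/(sl_mxP (f (gen_var 0 i))).
exists x => // v; apply: val_inj; rewrite /= gen_slE //; apply/matrixP => p q.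
rewrite mxE; case: eqP => [E|/eqP E]; first by rewrite /x /= E gen_varK.
by have /vasilovsky_compP -> := fG v.
Qed.

(** * The relatively free algebra as an algebra of matrix functions *)

Local Notation A := (relfree Gam k).
Local Notation qpi := (idealQuot_pi (preimage_ideal (rel_incl_morphism Gam k) (TG Gam))).

Definition term_rel (t : lieTerm K X) : A := qpi (free_pi t).

Lemma term_rel_surj (a : A) : exists t, a = term_rel t.
Proof.
have [f ->] := idealQuot_pi_surj a.
by exists (repr f); rewrite /term_rel free_piK.
Qed.

Lemma term_rel_lie s t : term_rel (TLie s t) = lie (term_rel s) (term_rel t).
Proof. by rewrite /term_rel free_pi_lie; apply: (idealQuot_pi_morphism _).2. Qed.

Lemma term_rel_lin a s t : term_rel (TAdd (TScale a s) t) = a *: term_rel s + term_rel t.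
Proof.
by rewrite /term_rel free_piD free_piZ; apply: (idealQuot_pi_morphism _).1.
Qed.

Lemma term_rel0 : term_rel TZero = 0.
Proof. exact/idealQuot_pi_eq0/ideal0. Qed.

Lemma term_relD s t : term_rel (TAdd s t) = term_rel s + term_rel t.
Proof.
by rewrite -[term_rel s]scale1r -term_rel_lin /term_rel !free_piD free_piZ scale1r.
Qed.

Lemma term_relZ c s : term_rel (TScale c s) = c *: term_rel s.
Proof.
by rewrite -[RHS]addr0 -term_rel0 -term_rel_lin /term_rel free_piD [free_pi TZero]lieQuot_pi0 addr0.
Qed.

Lemma eval_rel_incl (Phi : gvar 'Z_n -> sl K n) f :
  lie_eval Phi (rel_incl f) = lie_eval (fun v : X => Phi (relvar_gvar v)) f.
Proof.
have [ilin ilie] := rel_incl_morphism Gam k.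
have [plin plie] := lie_eval_morphism Phi.
apply: (lie_eval_unique (h := fun f => lie_eval Phi (rel_incl f))) => [|v].
  by split=> [a x y|x y]; rewrite ?ilin ?plin ?ilie ?plie.
by rewrite /rel_incl !lie_eval_var.
Qed.

(** A substitution for the variables of the relatively free algebra extends, by
    zero, to one for all graded variables, and there graded identities vanish. *)
Lemma eval_relfree_wd x f g : trace_free x -> qpi f = qpi g ->
  lie_eval (gen_sl x) f = lie_eval (gen_sl x) g.
Proof.
move=> x0 /lieQuot_piP.
pose Phi (w : gvar 'Z_n) := if insub w.2 is Some i then gen_sl x (gen_var w.1 i) else 0.
move=> /(_ Phi) /=; rewrite eval_rel_incl => H.
have PhiE (v : X) : Phi (relvar_gvar v) = gen_sl x v.
  by rewrite /Phi /= valK gen_varK.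
have [elin _] := lie_eval_morphism (fun v : X => Phi (relvar_gvar v)).
have eE h : lie_eval (fun v : X => Phi (relvar_gvar v)) h = lie_eval (gen_sl x) h.
  by apply: lie_eval_unique => [|v]; [exact: lie_eval_morphism|rewrite lie_eval_var].
have := H _; rewrite -scaleN1r addrC elin !eE scaleN1r addrC => H'.
apply/eqP; rewrite -subr_eq0; apply/eqP/H' => -[g' i]; rewrite /Phi /=.
case: insubP => [j _ _|_]; first exact: (gen_sl_graded (gen_var g' j)).
by have [] := @vasilovsky_subspace K n g'.
Qed.

Definition at_pt (x : idx -> K) (a : A) : 'M[K]_n :=
  sl_mx (lie_eval (gen_sl x) (repr a)).

Section AtPoint.
Context (x : idx -> K) (x0 : trace_free x).

Lemma at_qpi f : at_pt x (qpi f) = sl_mx (lie_eval (gen_sl x) f).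
Proof.
by rewrite /at_pt; congr sl_mx; apply: eval_relfree_wd => //; apply: lieQuot_piK.
Qed.

Lemma at_term_rel t : at_pt x (term_rel t) = meval idfun (gen x) t.
Proof.
rewrite at_qpi lie_eval_pi meval_sl; apply: eq_meval => v; exact: gen_slE.
Qed.

Lemma at_linear : linear (at_pt x).
Proof.
move=> c a b; have [s ->] := term_rel_surj a; have [t ->] := term_rel_surj b.
by rewrite -term_rel_lin !at_term_rel.
Qed.

Lemma at_lie a b :
  at_pt x (lie a b) = at_pt x a *m at_pt x b - at_pt x b *m at_pt x a.
Proof.
have [s ->] := term_rel_surj a; have [t ->] := term_rel_surj b.
by rewrite -term_rel_lie !at_term_rel.
Qed.

Lemma at_sum (I : finType) (c : I -> K) (b : I -> A) :
  at_pt x (\sum_i c i *: b i) = \sum_i c i *: at_pt x (b i).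
Proof.
have at0 : at_pt x 0 = 0 by rewrite -term_rel0 at_term_rel.
by elim/big_rec2: _ => // i a M _ <-; rewrite at_linear.
Qed.

End AtPoint.

(** Every graded substitution is a point, so vanishing at all points means being
    a graded identity. *)
Lemma at_pt_inj a : (forall x, trace_free x -> at_pt x a = 0) -> a = 0.
Proof.
have [t ->] := term_rel_surj a => H; apply/idealQuot_pi_eq0 => Phi PhiG.
rewrite eval_rel_incl lie_eval_pi.
have [x x0 xE] : exists2 x, trace_free x & (fun v : X => Phi (relvar_gvar v)) =1 gen_sl x.
  by apply: graded_gen_sl => v; exact: (PhiG (relvar_gvar v)).
apply: val_inj; rewrite /= meval_sl -[RHS](H x x0) at_term_rel //.
by apply: eq_meval => v; rewrite xE gen_slE.
Qed.

Definition gauge (S : comNzRingType) (x : idx -> S) : Prop :=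
  forall p q : 'I_n, q = p.+1 :> nat -> x (ord0, p, q) = 1.

(** Conjugation by the diagonal matrix with entries [tau] normalises the
    superdiagonal of the first generic element of degree one. *)
Lemma torus_gauge (x : idx -> K) t :
  trace_free x -> (forall p q : 'I_n, q = p.+1 :> nat -> x (ord0, p, q) != 0) ->
  (forall y, trace_free y -> gauge y -> meval idfun (gen y) t = 0) ->
  meval idfun (gen x) t = 0.
Proof.
move=> x0 xn0 H.
(* Chosen so that [tau p * x (0, p, p + 1) = tau (p + 1)]. *)
pose tau (p : nat) : K := \prod_(0 <= j < p) x (ord0, inord j, inord j.+1).
have tau0 (p : 'I_n) : tau p != 0.
  rewrite prodf_seq_neq0; apply/allP => j; rewrite mem_index_iota /= => jp.
  apply: xn0; have pn := ltn_ord p.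
  by rewrite !inordK //; apply: leq_trans pn => //; apply: ltnW.
pose y (u : idx) := tau u.1.2 * x u * (tau u.2)^-1.
pose D : 'M[K]_n := diag_mx (\row_p tau p).
pose D' : 'M[K]_n := diag_mx (\row_p (tau p)^-1).
have DD (d d' : 'I_n -> K) : (forall p, d p * d' p = 1) ->
    diag_mx (\row_p d p) *m diag_mx (\row_p d' p) = 1%:M :> 'M[K]_n.
  move=> dd; rewrite mulmx_diag; apply/matrixP => p q; rewrite !mxE.
  by rewrite dd.
have DD' : D' *m D = 1%:M by apply: DD => p; rewrite mulVf.
have D'D : D *m D' = 1%:M by apply: DD => p; rewrite mulfV.
have yE v : gen y v = D *m gen x v *m D'.
  apply/matrixP => p q; rewrite mul_mx_diag mul_diag_mx !mxE.
  by case: ifP => _; rewrite ?mulr0 ?mul0r.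
have : meval idfun (gen y) t = 0.
  apply: H => [i|p q pq].
    rewrite -[RHS](x0 i); apply: eq_bigr => p _.
    by rewrite /y /= mulrAC mulfV // mul1r.
  have xp : x (ord0, p, q) != 0 by apply: xn0.
  rewrite /y /= pq {2}/tau big_nat_recr //= -/(tau p).
  by rewrite inord_val -pq inord_val divff // mulf_neq0.
rewrite (eq_meval _ _ yE) meval_conj // => /(congr1 (fun M => D' *m M *m D)).
by rewrite !mulmxA DD' mul1mx -mulmxA DD' mulmx1 mulmx0 mul0mx.
Qed.

(** The normalisable points are dense: on the line through the point with all
    off-diagonal entries equal to one, only finitely many are not. *)
Lemma at_gauge_inj a : [pchar K] =i pred0 ->
  (forall x, trace_free x -> gauge x -> at_pt x a = 0) -> a = 0.
Proof.
move=> charK; have [t ->] := term_rel_surj a => H; apply: at_pt_inj => x x0.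
rewrite at_term_rel //.
pose x1 (u : idx) : K := (u.1.2 != u.2)%:R.
pose xs (u : idx) : {poly K} := (x1 u)%:P + 'X * (x u - x1 u)%:P.
have map_xs s : map_mx (horner_eval s) (meval polyC (gen xs) t) =
    meval idfun (gen (fun u => (xs u).[s])) t.
  rewrite map_meval; transitivity (meval (horner_eval s \o polyC)
    (gen (fun u => (xs u).[s])) t); first by apply: eq_meval => v; rewrite map_gen.
  by congr meval; apply/funext => c; rewrite /= /horner_eval hornerC.
have trace_free_xs s : trace_free (fun u => (xs u).[s]).
  move=> i; rewrite /xs /x1 -[RHS](mulr0 s) -[in RHS](x0 i) mulr_sumr.
  by apply: eq_bigr => p _; rewrite !hornerE eqxx subr0 add0r.
(* [Q] vanishes exactly at the points of the line that cannot be normalised. *)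
pose Q := \prod_(u : idx | (u.1.1 == ord0) && (u.2 == u.1.2.+1 :> nat)) xs u.
have Q0 : Q != 0.
  rewrite prodf_seq_neq0; apply/allP => -[[i p] q] _; apply/implyP => /=.
  move=> /andP[_ /eqP pq]; apply: contra_eq_neq (oner_eq0 K) => xs0.
  have := horner0 (0 : K); rewrite -xs0 !hornerE /x1 /= => <-.
  suff -> : p != q by rewrite eqxx.
  by rewrite -val_eqE /= pq neq_ltn ltnSn.
suff G0 : meval polyC (gen xs) t = 0.
  have := map_xs 1; rewrite G0 map_mx0 => ->; congr meval.
  by apply/funext => v; congr gen; apply/funext => u; rewrite !hornerE /= addrC addKr.
apply/matrixP => p q; rewrite mxE; apply: (mulfI Q0); rewrite mulr0.
apply: (poly_eq0_horner charK) => s; rewrite hornerM.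
have [->|Qs] := eqVneq Q.[s] 0; first by rewrite mul0r.
have -> : (meval polyC (gen xs) t p q).[s] =
    (map_mx (horner_eval s) (meval polyC (gen xs) t)) p q by rewrite mxE.
rewrite map_xs torus_gauge ?mxE ?mulr0 //; last first.
  by move=> y y0 yg; rewrite -at_term_rel // H.
move=> i j ij; apply: contra Qs => xij; rewrite /Q horner_prod.
by rewrite (bigD1 (ord0, i, j)) /= ?eqxx ?ij ?(eqP xij) ?mul0r.
Qed.

End GenericElements.

(** * Coordinates on the normalised generic elements *)

Section Coordinates.
Context (K : fieldType) (charK : [pchar K] =i pred0) (m k' : nat).
Local Notation n := m.+3.
Local Notation k := k'.+1.
Local Notation Gam := (vasilovsky K n).
Local Notation X := (relvar Gam k).
Local Notation idx := (idx m k').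

(** Removed are the last diagonal entries, determined by the trace, and the
    superdiagonal of the first element of degree one, normalised by the torus. *)
Definition free_idx : {set idx} :=
  [set u : idx | ~~ ((u.1.2 == ord_max) && (u.2 == ord_max)) &
                 ~~ ((u.1.1 == ord0) && (u.2 == u.1.2.+1 :> nat))]%SET.

Lemma card_free_idx : (#|free_idx| + (k + n.-1) = k * n ^ 2)%N.
Proof.
pose E1 : {set idx} := [set (i, ord_max, ord_max) | i in 'I_k]%SET.
pose f2 (p : 'I_n.-1) : idx := (ord0, widen_ord (leqnSn _) p, lift ord0 p).
pose E2 : {set idx} := [set f2 p | p in 'I_n.-1]%SET.
have cE1 : #|E1| = k by rewrite card_imset ?card_ord // => i j [].
have cE2 : #|E2| = n.-1.
  by rewrite card_imset ?card_ord // => i j /(congr1 (fun u : idx => val u.1.2)) /= /val_inj.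
have -> : free_idx = ~: (E1 :|: E2).
  apply/setP => -[[i p] q]; rewrite !inE negb_or; congr (~~ _ && ~~ _).
    apply/andP/imsetP => [[/eqP /= -> /eqP ->]|[j _ [_ -> ->]]]; first by exists i.
    by rewrite !eqxx.
  apply/andP/imsetP => /= [[/eqP -> /eqP qp]|[j _ [-> -> ->]]]; last first.
    by rewrite !eqxx.
  have pn : (p < n.-1)%N by rewrite -ltnS -qp.
  by exists (Ordinal pn) => //; congr (_, _, _); apply: val_inj; rewrite //= qp.
have cU : #|E1 :|: E2| = (k + n.-1)%N.
  rewrite cardsU cE1 cE2 disjoint_setI0 ?cards0 ?subn0 //.
  apply/pred0P => u; apply/negP => /andP[/imsetP[i _ ->] /imsetP[j _]].
  move=> /(congr1 (fun u : idx => val u.1.2)) /= E.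
  by have := ltn_ord j; rewrite -E ltnn.
by rewrite -cU addnC cardsC !card_prod !card_ord -mulnA.
Qed.

Local Notation t := #|free_idx|.

Section Directions.
Context (S : comNzRingType).
Implicit Types (y : 'rV[S]_t) (u : idx).

Definition coord y u : S := \sum_(j < t | enum_val j == u) y 0 j.

(** The tangent vector of the slice with free coordinates [y]: the last diagonal
    entry restores the trace, and the normalised entries do not move. *)
Definition dir y u : S := coord y u -
  (if (u.1.2 == ord_max) && (u.2 == ord_max) then \sum_p coord y (u.1.1, p, p)
   else 0).

Lemma coord_free y j : coord y (enum_val j) = y 0 j.
Proof.
rewrite /coord (bigD1 j) //= big1 ?addr0 // => i /andP[/eqP /enum_val_inj ->].
by rewrite eqxx.
Qed.

Lemma coord_notfree y u : u \notin free_idx -> coord y u = 0.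
Proof.
by move=> uF; apply: big1 => j /eqP ju; rewrite -ju enum_valP in uF.
Qed.

Lemma dir_free y j : dir y (enum_val j) = y 0 j.
Proof.
rewrite /dir; have := enum_valP j; rewrite inE => /andP[/negbTE -> _].
by rewrite subr0 coord_free.
Qed.

Lemma trace_free_dir y : trace_free (dir y).
Proof.
move=> i; rewrite /dir /= sumrB [X in _ - X](bigD1 ord_max) //= eqxx.
rewrite [X in _ - (_ + X)]big1 ?addr0 ?subrr // => p /negbTE ->.
by [].
Qed.

Lemma dir_gauge y (p q : 'I_n) : q = p.+1 :> nat -> dir y (ord0, p, q) = 0.
Proof.
move=> qp; rewrite /dir /= coord_notfree ?inE /= ?qp ?eqxx ?andbF // sub0r.
case: eqP => [pE|]; rewrite ?oppr0 //.
by have := ltn_ord q; rewrite qp pE ltnn.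
Qed.

Lemma dir_linear a y z u : dir (a *: y + z) u = a * dir y u + dir z u.
Proof.
have cl w : coord (a *: y + z) w = a * coord y w + coord z w.
  rewrite /coord mulr_sumr -big_split; apply: eq_bigr => j _.
  by rewrite !mxE.
rewrite /dir cl; case: ifP => _; last by rewrite !subr0.
under eq_bigr do rewrite cl.
rewrite big_split /= -mulr_sumr; ring.
Qed.

Lemma dirZ a y u : dir (a *: y) u = a * dir y u.
Proof.
have dir0 : dir 0 u = 0.
  by have := dir_linear (-1) 0 0 u; rewrite scaler0 addr0 mulN1r addNr.
by have := dir_linear a y 0 u; rewrite dir0 !addr0.
Qed.

Lemma dir_surj (v : idx -> S) : trace_free v ->
  (forall p q : 'I_n, q = p.+1 :> nat -> v (ord0, p, q) = 0) ->
  exists y, dir y =1 v.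
Proof.
move=> v0 vg; pose y : 'rV[S]_t := \row_(j < t) v (enum_val j).
have cE u : coord y u = if u \in free_idx then v u else 0.
  case: ifP => [uF|/negbT]; last exact: coord_notfree.
  by rewrite -(enum_rankK_in uF uF) coord_free mxE.
exists y => -[[i p] q]; rewrite /dir cE !inE /=.
have [/andP[/eqP -> /eqP ->]|pq] /= := boolP ((p == ord_max) && (q == ord_max)).
  rewrite sub0r (eq_bigr (fun p => if p == ord_max then 0 else v (i, p, p))).
    apply/eqP; rewrite eq_sym -subr_eq0 opprK -[X in _ == X](v0 i).
    rewrite [X in _ == X](bigD1 ord_max) //= (bigD1 ord_max) //= eqxx add0r.
    by rewrite (eq_bigr (fun p => v (i, p, p))) // => r /negbTE ->.
  move=> r _; rewrite cE inE /= andbb.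
  by rewrite [r == r.+1 :> nat]ltn_eqF ?andbF ?andbT //; case: (r == _).
rewrite subr0; case: ifP => // /negbFE /andP[/eqP -> /eqP qp].
by rewrite vg.
Qed.

End Directions.

(** Powers of two have pairwise distinct differences, by uniqueness of binary
    expansions; subtracting the mean makes the trace vanish. *)
Definition spread (p : 'I_n) : K := 2 ^+ p - (\sum_(q < n) 2 ^+ q) / n%:R.

Lemma spread_sum0 : \sum_p spread p = 0.
Proof.
rewrite sumrB sumr_const card_ord -[X in _ - X]mulr_natr divfK ?subrr //.
by rewrite (char0_natr_eq0 charK).
Qed.

Lemma spread_inj (p q p' q' : 'I_n) : p != q ->
  spread p - spread q = spread p' - spread q' -> p = p' /\ q = q'.
Proof.
move=> pq E; have {}E : 2 ^+ p + 2 ^+ q' = 2 ^+ p' + 2 ^+ q :> K.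
  apply/eqP; rewrite -subr_eq0; apply/eqP.
  transitivity (spread p - spread q - (spread p' - spread q')).
    by rewrite /spread; ring.
  by rewrite E subrr.
have /expn2_sum_inj : (2 ^ p + 2 ^ q' = 2 ^ p' + 2 ^ q)%N.
  by apply: (char0_natr_inj charK); rewrite !natrD !natrX.
case=> [[/val_inj -> /val_inj ->] //|[/val_inj pq']].
by rewrite pq' eqxx in pq.
Qed.

(** The point of the slice at which the differential is computed. *)
Definition base (u : idx) : K := if u.1.2 == u.2 then spread u.1.2 else 1.

Definition pt (y : 'rV[K]_t) (u : idx) : K := base u + dir y u.

Lemma trace_free_pt y : trace_free (pt y).
Proof.
move=> i; rewrite /pt big_split /= trace_free_dir addr0 -[RHS]spread_sum0.
by apply: eq_bigr => p _; rewrite /base eqxx.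
Qed.

Lemma base_gauge : gauge base.
Proof.
by move=> p q qp; rewrite /base /= -val_eqE /= qp ltn_eqF.
Qed.

Lemma pt_gauge y : gauge (pt y).
Proof. by move=> p q qp; rewrite /pt base_gauge // dir_gauge // addr0. Qed.

Lemma pt_surj x : trace_free x -> gauge x -> exists y, x = pt y.
Proof.
move=> x0 xg; have [|p q qp|y yE] := @dir_surj K (fun u => x u - base u).
- move=> i; rewrite sumrB x0 sub0r; apply/eqP; rewrite oppr_eq0; apply/eqP.
  by rewrite -[RHS]spread_sum0; apply: eq_bigr => p _; rewrite /base eqxx.
- by rewrite xg // base_gauge // subrr.
by exists y; apply/funext => u; rewrite /pt yE addrC subrK.
Qed.

(** * Upper bound on the growth *)

Definition monom (e : 'I_t -> nat) (y : 'rV[K]_t) : K := \prod_j y 0 j ^+ e j.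

(** The degree is bounded by [d] in each coordinate separately. *)
Definition polyfun (d : nat) (f : 'rV[K]_t -> K) : Prop :=
  exists c : {ffun 'I_t -> 'I_d.+1} -> K, forall y, f y = \sum_a c a * monom (val \o a) y.

Lemma polyfun_monom d e : (forall j, e j <= d)%N -> polyfun d (monom e).
Proof.
move=> ed; pose a : {ffun 'I_t -> 'I_d.+1} := [ffun j => inord (e j)].
exists (fun b => (b == a)%:R) => y; rewrite (bigD1 a) //= eqxx mul1r big1 ?addr0.
  by apply: eq_bigr => j _; rewrite /= ffunE inordK ?ltnS.
by move=> b /negbTE ->; rewrite mul0r.
Qed.

Lemma polyfun_lin d a f g : polyfun d f -> polyfun d g ->
  polyfun d (fun y => a * f y + g y).
Proof.
move=> [c cE] [b bE]; exists (fun e => a * c e + b e) => y.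
rewrite cE bE mulr_sumr -big_split; apply: eq_bigr => e _ /=.
by rewrite mulrDl mulrA.
Qed.

Lemma polyfun_ext d f g : f =1 g -> polyfun d f -> polyfun d g.
Proof. by move=> fg [c cE]; exists c => y; rewrite -fg. Qed.

Lemma polyfun0 d : polyfun d (fun=> 0).
Proof. by exists (fun=> 0) => y; rewrite big1 // => e _; rewrite mul0r. Qed.

Lemma polyfunZ d a f : polyfun d f -> polyfun d (fun y => a * f y).
Proof.
move=> /(polyfun_lin a) /(_ (polyfun0 d)); apply: polyfun_ext => y.
by rewrite addr0.
Qed.

Lemma polyfunD d f g : polyfun d f -> polyfun d g -> polyfun d (fun y => f y + g y).
Proof.
move=> fP /(polyfun_lin 1 fP); apply: polyfun_ext => y.
by rewrite mul1r.
Qed.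

Lemma polyfun_sum d (I : Type) (r : seq I) (P : pred I) (F : I -> 'rV[K]_t -> K) :
  (forall i, P i -> polyfun d (F i)) ->
  polyfun d (fun y => \sum_(i <- r | P i) F i y).
Proof.
move=> FP; elim: r => [|i r IHr].
  by apply: polyfun_ext (polyfun0 d) => y; rewrite big_nil.
case Pi: (P i); last by apply: polyfun_ext IHr => y; rewrite big_cons Pi.
by apply: polyfun_ext (polyfunD (FP i Pi) IHr) => y; rewrite big_cons Pi.
Qed.

Lemma polyfunM d d' f g : polyfun d f -> polyfun d' g ->
  polyfun (d + d') (fun y => f y * g y).
Proof.
move=> [c cE] [b bE].
apply: polyfun_ext (_ : polyfun _ (fun y => \sum_e \sum_e' c e * b e' *
    monom (fun j => e j + e' j)%N y)) => [y|].
  rewrite cE bE mulr_suml; apply: eq_bigr => e _; rewrite mulr_sumr.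
  apply: eq_bigr => e' _; rewrite [RHS]mulrACA; congr (_ * _).
  by rewrite -big_split; apply: eq_bigr => j _; rewrite exprD.
apply: polyfun_sum => e _; apply: polyfun_sum => e' _.
apply/polyfunZ/polyfun_monom => j.
by apply: leq_add; rewrite -ltnS.
Qed.

Lemma polyfun_leq d d' f : (d <= d')%N -> polyfun d f -> polyfun d' f.
Proof.
move=> dd [c cE]; apply: polyfun_ext (fun y => esym (cE y)) _.
apply: polyfun_sum => e _; apply/polyfunZ/polyfun_monom => j.
by apply: leq_trans _ dd; rewrite -ltnS /=.
Qed.

Lemma polyfun_pt u : polyfun 1 (fun y => pt y u).
Proof.
have pf1 : polyfun 1 (fun=> 1).
  apply: polyfun_ext (@polyfun_monom 1 (fun=> 0%N) _) => // y.
  by apply: big1 => j _; rewrite expr0.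
have pc w : polyfun 1 (fun y => coord y w).
  apply: polyfun_sum => j _.
  apply: polyfun_ext (@polyfun_monom 1 (fun i => (i == j) : nat) _) => [y|i].
    rewrite /monom (bigD1 j) //= eqxx expr1 big1 ?mulr1 // => i /negbTE ->.
    by rewrite expr0.
  by case: (_ == _).
apply: (@polyfunD _ (fun=> base u) (fun y => dir y u)).
  by apply: polyfun_ext (polyfunZ (base u) pf1) => y; rewrite mulr1.
pose f (y : 'rV[K]_t) := if (u.1.2 == ord_max) && (u.2 == ord_max)
  then \sum_p coord y (u.1.1, p, p) else 0.
have fP : polyfun 1 f.
  by rewrite /f; case: (_ && _); [apply: polyfun_sum|exact: polyfun0].
by apply: polyfun_ext (polyfunD (pc u) (polyfunZ (-1) fP)) => y; rewrite mulN1r.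
Qed.

Local Notation A := (relfree Gam k).

Definition entries_deg (d : nat) : set A :=
  [set a | forall p q, polyfun d (fun y => at_pt (pt y) a p q)].

Lemma entries_deg_subspace d : Defs.subspace (entries_deg d).
Proof.
split=> [p q|a u v uP vP p q].
  apply: polyfun_ext (polyfun0 d) => y.
  by rewrite -term_rel0 at_term_rel ?mxE //; apply: trace_free_pt.
apply: polyfun_ext (polyfun_lin a (uP p q) (vP p q)) => y.
by rewrite at_linear ?mxE //; apply: trace_free_pt.
Qed.

Lemma entries_deg_leq d d' : (d <= d')%N -> entries_deg d `<=` entries_deg d'.
Proof. by move=> dd a aP p q; apply: polyfun_leq (aP p q). Qed.

Lemma entries_deg_lie d d' a b : entries_deg d a -> entries_deg d' b ->
  entries_deg (d + d') (lie a b).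
Proof.
move=> aP bP p q.
have mulP e e' u v : entries_deg e u -> entries_deg e' v ->
    polyfun (e + e') (fun y => (at_pt (pt y) u *m at_pt (pt y) v) p q).
  move=> uP vP; apply: polyfun_ext (polyfun_sum (index_enum 'I_n) (P := xpredT)
    (fun r _ => polyfunM (uP p r) (vP r q))) => y.
  by rewrite mxE.
apply: polyfun_ext (polyfun_lin (-1)
  (polyfun_leq (eq_leq (addnC d' d)) (mulP _ _ _ _ bP aP)) (mulP _ _ _ _ aP bP)) => y.
by rewrite at_lie; [rewrite [RHS]mxE [X in _ = _ + X]mxE addrC mulN1r|exact: trace_free_pt].
Qed.

Lemma entries_deg_exists a : exists d, entries_deg d a.
Proof.
have [s ->] := term_rel_surj a; elim: s => [v||s [d ds] t [d' dt]|c s [d ds]|s [d ds] t [d' dt]].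
- exists 1%N => p q; apply: polyfun_ext
    (_ : polyfun 1 (fun y => if unit_deg p q == \val v.1 then pt y (v.2, p, q) else 0)) => [y|].
    by rewrite at_term_rel ?mxE //; apply: trace_free_pt.
  by case: (unit_deg p q == _); [exact: polyfun_pt|exact: polyfun0].
- by exists 0%N; rewrite term_rel0; have [] := entries_deg_subspace 0.
- exists (maxn d d'); rewrite term_relD.
  apply: (subspaceD (entries_deg_subspace _)).
    exact: entries_deg_leq (leq_maxl _ _) _ ds.
  exact: entries_deg_leq (leq_maxr _ _) _ dt.
- by exists d; rewrite term_relZ; apply: (subspaceZ _ (entries_deg_subspace _)).
- by exists (d + d')%N; rewrite term_rel_lie; apply: entries_deg_lie.
Qed.

(** An element is determined by its [n ^ 2] entries on the slice, and each entry
    has [d.+1 ^ t] coefficients. *)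
Lemma indep_entries_deg d r (b : 'I_r -> A) : indep b ->
  (forall i, entries_deg d (b i)) -> (r <= n ^ 2 * d.+1 ^ t)%N.
Proof.
move=> bI bP.
have /choice[c cE] : forall i, exists c : 'I_n * 'I_n * {ffun 'I_t -> 'I_d.+1} -> K,
    forall p q y, at_pt (pt y) (b i) p q = \sum_a c (p, q, a) * monom (val \o a) y.
  move=> i; have /choice[c cE] : forall pq : 'I_n * 'I_n, exists c : _ -> K, forall y,
      at_pt (pt y) (b i) pq.1 pq.2 =
      \sum_(a : {ffun 'I_t -> 'I_d.+1}) c a * monom (val \o a) y.
    by move=> pq; apply: bP.
  by exists (fun w => c w.1 w.2) => p q y; rewrite (cE (p, q)).
pose J := ('I_n * 'I_n * {ffun 'I_t -> 'I_d.+1})%type.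
have -> : (n ^ 2 * d.+1 ^ t = #|{: J}|)%N.
  by rewrite !card_prod card_ffun !card_ord.
rewrite leqNgt; apply/negP => rJ.
pose C := \matrix_(i < r, j < #|{: J}|) c i (enum_val j).
have [u u0 uC] := left_kernel_nontrivial C rJ.
case/rV0Pn: u0 => i0; apply/negP; rewrite negbK; apply/eqP.
apply: (bI (fun i => u 0 i)); apply: (at_gauge_inj charK) => x x0 xg.
have [y ->] := pt_surj x0 xg; rewrite at_sum; last exact: trace_free_pt.
apply/matrixP => p q; rewrite summxE mxE.
under eq_bigr => i _ do rewrite mxE cE mulr_sumr.
rewrite exchange_big big1 // => a _ /=.
under eq_bigr => i _ do rewrite mulrA.
rewrite -mulr_suml (_ : \sum_i _ = (u *m C) 0 (enum_rank (p, q, a))).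
  by rewrite uC mxE mul0r.
by rewrite mxE; apply: eq_bigr => i _; rewrite mxE enum_rankK.
Qed.

Definition word_span (V : set A) (l : nat) : set A :=
  lspan [set x | exists2 i, (i <= l)%N & lie_word V i x].

(** The entries of a word of length [l] at a normalised point are polynomial
    functions of the [t] coordinates, of degree linear in [l]. *)
Lemma word_span_entries_deg (V : set A) : finite_set V ->
  exists c, forall l, word_span V l `<=` entries_deg (c * l).
Proof.
move=> /finite_seqP[s ->].
have [c sc] : exists c, forall v, v \in s -> entries_deg c v.
  elim: s => [|a s [c sc]]; first by exists 0%N.
  have [d ad] := entries_deg_exists a; exists (maxn c d) => v.
  rewrite inE => /orP[/eqP ->|/sc].
    exact: entries_deg_leq (leq_maxr _ _) _ ad.
  exact/entries_deg_leq/leq_maxl.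
exists c => l; apply: lspan_min; first exact: entries_deg_subspace.
move=> x [i il xi]; apply: entries_deg_leq (leq_mul (leqnn c) il) _ _.
elim: xi => {i x il} [v /sc|i j x y _ xP _ yP]; first by rewrite muln1.
by rewrite mulnDr; apply: entries_deg_lie.
Qed.

Lemma growth_bounds (V : set A) : finite_set V -> exists c,
  (forall l, growth V l <= n ^ 2 * (c * l).+1 ^ t)%N /\
  (forall l (I : finType) (b : I -> A), indep b ->
     (forall i, word_span V l (b i)) -> (#|I| <= growth V l)%N).
Proof.
move=> /word_span_entries_deg[c cP]; exists c.
have H l := @dimension_bounds _ _ (word_span V l) (n ^ 2 * (c * l).+1 ^ t)
  (@lspan_subspace _ _ _)
  (fun r b bI bW => indep_entries_deg bI (fun i => cP l _ (bW i))).
by split=> l; have [] := H l.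
Qed.

End Coordinates.

(** * Infinitesimal rigidity *)

Section Tangent.
Context (K : fieldType) (charK : [pchar K] =i pred0) (m k' : nat).
Local Notation n := m.+3.
Local Notation k := k'.+1.
Local Notation Gam := (vasilovsky K n).
Local Notation X := (relvar Gam k).
Local Notation idx := (idx m k').
Local Notation t := #|free_idx m k'|.

(** Iterated commutators of variables are homogeneous, and they suffice for the
    lower bound; on other terms [tdeg] is meaningless. *)
Fixpoint mono (s : lieTerm K X) : bool :=
  match s with
  | TVar _ => true
  | TLie s s' => mono s && mono s'
  | _ => false
  end.

Fixpoint tdeg (s : lieTerm K X) : 'Z_n :=
  match s with
  | TVar v => \val v.1
  | TLie s s' => tdeg s + tdeg s'
  | _ => 0
  end.

Section Support.
Context (S : comNzRingType) (c : K -> S) (x : idx -> S).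
Local Notation ev := (meval c (@gen K m k' S x)).

Lemma meval_supp s p q : mono s -> unit_deg p q != tdeg s -> ev s p q = 0.
Proof.
elim: s p q => //= [v|s IHs s' IHs'] p q.
  by move=> _ /negbTE pq; rewrite mxE pq.
move=> /andP[ms ms'] pq; rewrite !mxE !big1 ?subrr // => r _.
  have [E|] := eqVneq (unit_deg p r) (tdeg s'); last by move=> /(IHs' _ _ ms') ->; rewrite mul0r.
  rewrite (IHs r q) ?mulr0 //; apply: contra pq => /eqP <-.
  by rewrite -E addrC unit_degD.
have [E|] := eqVneq (unit_deg p r) (tdeg s); last by move=> /(IHs _ _ ms) ->; rewrite mul0r.
rewrite (IHs' r q) ?mulr0 //; apply: contra pq => /eqP <-.
by rewrite -E unit_degD.
Qed.

Lemma meval_lie s s' p q :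
  ev (TLie s s') p q = \sum_r ev s p r * ev s' r q - \sum_r ev s' p r * ev s r q.
Proof. by rewrite /= [LHS]mxE [X in _ + X]mxE !mxE. Qed.

Lemma meval_trace s : trace_free x -> \tr (ev s) = 0.
Proof.
move=> x0; elim: s => //= [v||s IHs s' IHs'|a s IHs|s _ s' _].
- exact: trace_gen.
- exact: mxtrace0.
- by rewrite mxtraceD IHs IHs' addr0.
- by rewrite mxtraceZ IHs mulr0.
- by rewrite linearB /= mxtrace_mulC subrr.
Qed.

(** An element of degree zero is diagonal. *)
Lemma meval_lie_diag h s p q : mono h -> tdeg h = 0 ->
  ev (TLie h s) p q = (ev h p p - ev h q q) * ev s p q.
Proof.
move=> mh h0; rewrite meval_lie.
rewrite (big_only1 p) // => [|r rp _]; last first.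
  by rewrite meval_supp ?mul0r // h0 unit_deg_eq0 eq_sym.
rewrite (big_only1 q) // => [|r rp _]; last first.
  by rewrite (@meval_supp h) ?mulr0 // h0 unit_deg_eq0.
by rewrite mulrBl [ev s p q * _]mulrC.
Qed.

End Support.

Lemma coef1M (f g : {poly K}) : (f * g)`_1 = f`_0 * g`_1 + f`_1 * g`_0.
Proof. by rewrite coefM !big_ord_recl big_ord0 addr0. Qed.

Lemma coef0X (f : {poly K}) a : (f ^+ a)`_0 = f`_0 ^+ a.
Proof. by rewrite -!horner_coef0 horner_exp. Qed.

Lemma coef1X (f : {poly K}) a : (f ^+ a)`_1 = (f`_0 ^+ a.-1 *+ a) * f`_1.
Proof.
elim: a => [|a IHa]; first by rewrite expr0 coefC mulr0n mul0r.
rewrite exprS coef1M IHa coef0X /=; case: a {IHa} => [|a] /=.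
  by rewrite mulr0n mul0r mulr0 add0r expr0 mulr1 mulr1n mul1r.
by rewrite mulrA mulrnAr -exprS [f`_1 * _]mulrC -mulrDl -mulrSr.
Qed.

(** The line through the base point in direction [y]; its coefficients of order
    0 and 1 are the value and the derivative in that direction. *)
Definition xline (y : 'rV[K]_t) (u : idx) : {poly K} :=
  (base K u)%:P + 'X * (dir y u)%:P.

Lemma xline0 y u : (xline y u)`_0 = base K u.
Proof. by rewrite coefD coefC coefXM addr0. Qed.

Lemma xline1 y u : (xline y u)`_1 = dir y u.
Proof. by rewrite coefD coefC coefXM coefC add0r. Qed.

Lemma trace_free_xline y : trace_free (xline y).
Proof.
move=> i; rewrite /xline big_split /= -mulr_sumr -!raddf_sum /= trace_free_dir mulr0 addr0.
rewrite (_ : \sum_p _ = 0) // -[RHS](spread_sum0 charK m).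
by apply: eq_bigr => p _; rewrite /base eqxx.
Qed.

Section Direction.
Context (y : 'rV[K]_t).
Local Notation L := (meval polyC (@gen K m k' _ (xline y))).

Definition ad_diag : lieTerm K X := TVar (gen_var K 0 ord0).
Definition elem (p q : 'I_n) (i : 'I_k) : lieTerm K X := TVar (gen_var K (unit_deg p q) i).

Lemma L_elem p q i : L (elem p q i) p q = xline y (i, p, q).
Proof. by rewrite mxE /= eqxx. Qed.

Lemma L_ad_iter a s p q : L (iter a (TLie ad_diag) s) p q =
  (xline y (ord0, p, p) - xline y (ord0, q, q)) ^+ a * L s p q.
Proof.
elim: a => [|a IHa]; first by rewrite mul1r.
by rewrite iterS meval_lie_diag // IHa mulrA exprS !mxE !unit_degpp /=.
Qed.

Lemma mono_ad_iter a s : mono s -> mono (iter a (TLie ad_diag) s).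
Proof. by move=> ms; elim: a. Qed.

Lemma tdeg_ad_iter a s : tdeg (iter a (TLie ad_diag) s) = tdeg s.
Proof. by elim: a => //= a ->; rewrite add0r. Qed.

(** The derivative of [[ad D ^ a s, s']] is an exponential polynomial in [a]
    whose nodes, the differences of the entries of [D], are distinct; so the
    matrix positions can be separated from each other. *)
Lemma tangent_separation (mu : 'I_n -> K) :
  (forall h, mono h -> tdeg h = 0 -> \sum_p mu p * (L h p p)`_1 = 0) ->
  forall (p q : 'I_n) s s', p != q -> mono s -> mono s' ->
    tdeg s = unit_deg p q -> tdeg s' = unit_deg q p ->
    (mu p - mu q) * (L s p q * L s' q p)`_1 = 0.
Proof.
move=> Hmu p0 q0 s s' pq0 ms ms' ds ds'.
pose del (u : 'I_n * 'I_n) := xline y (ord0, u.1, u.1) - xline y (ord0, u.2, u.2).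
pose G (u : 'I_n * 'I_n) := L s u.1 u.2 * L s' u.2 u.1.
pose w (u : 'I_n * 'I_n) := mu u.1 - mu u.2.
have key (a : nat) : \sum_(u in [pred u : 'I_n * 'I_n | u.1 != u.2])
    (w u * (G u)`_1 * (del u)`_0 ^+ a +
     w u * (del u)`_1 * (G u)`_0 * ((del u)`_0 ^+ a.-1 *+ a)) = 0.
  pose h := TLie (iter a (TLie ad_diag) s) s'.
  have mh : mono h by rewrite /h /= mono_ad_iter.
  have h0 : tdeg h = 0 by rewrite /h /= tdeg_ad_iter ds ds' unit_degD unit_degpp.
  rewrite -[RHS](Hmu h mh h0).
  transitivity (\sum_u w u * (del u ^+ a * G u)`_1).
    rewrite [RHS](bigID [pred u | u.1 != u.2]) /= [X in _ + X]big1 ?addr0.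
      apply: eq_bigr => u _; rewrite (coef1M (del u ^+ a)) coef1X coef0X; ring.
    move=> [p q] /= /negPn /eqP ->; rewrite /G meval_supp ?mul0r ?mulr0 ?coef0 ?mulr0 //.
    by rewrite ds unit_degpp eq_sym unit_deg_eq0.
  transitivity (\sum_p \sum_q (mu p - mu q) * (del (p, q) ^+ a * G (p, q))`_1).
    by rewrite pair_big; apply: eq_bigr => -[].
  under eq_bigr => p _ do under eq_bigr => q _ do rewrite mulrBl.
  under eq_bigr => p _ do rewrite sumrB.
  rewrite sumrB [X in _ - X]exchange_big -sumrB; apply: eq_bigr => p _ /=.
  rewrite meval_lie.
  rewrite coefB !coef_sum mulrBr !mulr_sumr; congr (_ - _); apply: eq_bigr => q _.
    by rewrite L_ad_iter -mulrA.
  by rewrite L_ad_iter /G [L s' p q * _]mulrC -mulrA.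
have delE u : (del u)`_0 = spread K u.1 - spread K u.2.
  by rewrite coefB !xline0 /base !eqxx.
have := exp_sum_indep _ key => /(_ _ (p0, q0) pq0) [|//].
move=> [p q] [p' q'] pq _; rewrite !delE /=.
by move=> /(spread_inj charK pq) [] /= -> ->.
Qed.

Lemma base_off (p q : 'I_n) (i : 'I_k) : p != q -> base K (i, p, q) = 1.
Proof. by rewrite /base /= => /negbTE ->. Qed.

Definition ord_one : 'I_n := lift ord0 ord0.

(** The direction [y] is in the kernel of the differential of every function
    [h |-> h_00 - h_11]; the lemmas below show that [y] is then zero. *)
Context (alpha0 : forall h, mono h -> tdeg h = 0 ->
  (L h ord0 ord0 - L h ord_one ord_one)`_1 = 0).

(** Separation first applies with the functional [h_00 - h_11] only, which
    controls the entries [(0, q)]. Replacing [s] by [[h, s]] there multiplies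
    the entry by [h_00 - h_qq], so all these differences are stationary; the
    vanishing trace then makes each diagonal entry stationary. *)
Lemma tangent_diag0 h p : mono h -> tdeg h = 0 -> (L h p p)`_1 = 0.
Proof.
move=> mh h0; pose mu (p : 'I_n) : K := (p == ord0)%:R - (p == ord_one)%:R.
have Hmu g : mono g -> tdeg g = 0 -> \sum_p mu p * (L g p p)`_1 = 0.
  move=> mg g0; rewrite -[RHS](alpha0 mg g0) coefB (bigD1 ord0) //= (bigD1 ord_one) //=.
  rewrite big1 ?addr0; last first.
    by move=> q /andP[/negbTE q0 /negbTE q1]; rewrite /mu q0 q1 subrr mul0r.
  by rewrite /mu !eqxx /= subr0 sub0r mul1r mulN1r.
have hE q : (L h q q)`_1 = (L h ord0 ord0)`_1.
  have [->//|q0] := eqVneq q ord0.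
  have q0' : ord0 != q by rewrite eq_sym.
  pose s := elem ord0 q ord0; pose s' := elem q ord0 ord0.
  have muq : mu ord0 - mu q != 0.
    rewrite /mu eqxx (negbTE q0) /=; case: (q == ord_one); last first.
      by rewrite !subr0 oner_eq0.
    by rewrite subr0 sub0r opprK -[1 + 1]/(2%:R) (char0_natr_eq0 charK).
  have G1 : (L s ord0 q * L s' q ord0)`_1 = 0.
    have /eqP := tangent_separation Hmu q0' (s := s) (s' := s') isT isT erefl erefl.
    by rewrite mulf_eq0 (negbTE muq) => /eqP.
  have G0 : (L s ord0 q * L s' q ord0)`_0 = 1.
    by rewrite coef0M !L_elem !xline0 !base_off // mulr1.
  have /eqP := tangent_separation Hmu q0' (s := TLie h s) (s' := s')
    (introT andP (conj mh isT)) isT (etrans (congr1 (+%R^~ _) h0) (add0r _)) erefl.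
  rewrite mulf_eq0 (negbTE muq) meval_lie_diag // -mulrA coef1M G1 G0 mulr0 add0r mulr1.
  by rewrite coefB subr_eq0 => /eqP.
have : \tr (L h) = 0 by apply/meval_trace/trace_free_xline.
move=> /(congr1 (fun f : {poly K} => f`_1)); rewrite /mxtrace coef_sum coef0.
rewrite (eq_bigr _ (fun q _ => hE q)) sumr_const card_ord hE -mulr_natl.
by move/eqP; rewrite mulf_eq0 (char0_natr_eq0 charK) => /eqP.
Qed.

(** Once every diagonal entry is stationary, separation applies with each
    coordinate functional and reaches all positions. *)
Lemma tangent_pair p q s s' : p != q -> mono s -> mono s' ->
  tdeg s = unit_deg p q -> tdeg s' = unit_deg q p -> (L s p q * L s' q p)`_1 = 0.
Proof.
move=> pq ms ms' ds ds'.
have := @tangent_separation (fun r => (r == p)%:R) _ p q s s' pq ms ms' ds ds'.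
rewrite eqxx [q == p]eq_sym (negbTE pq) subr0 mul1r; apply=> h mh h0.
by rewrite big1 // => r _; rewrite tangent_diag0 // mulr0.
Qed.

Definition still (p q : 'I_n) : Prop :=
  forall s, mono s -> tdeg s = unit_deg p q -> (L s p q)`_1 = 0.

(** By [tangent_pair] one stationary nonzero entry at [(p, q)] makes all entries
    at [(q, p)] stationary, and going back, all those at [(p, q)]. *)
Lemma still_sym_of p q s : p != q -> mono s -> tdeg s = unit_deg p q ->
  (L s p q)`_0 != 0 -> (L s p q)`_1 = 0 -> still q p.
Proof.
move=> pq ms ds s0 s1 s' ms' ds'.
have /eqP := tangent_pair pq ms ms' ds ds'.
by rewrite coef1M s1 mul0r addr0 mulf_eq0 (negbTE s0) => /eqP.
Qed.

Lemma still_sym p q : p != q -> still p q -> still q p.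
Proof.
move=> pq pqS; apply: (@still_sym_of p q (elem p q ord0)) => //.
- by rewrite L_elem xline0 base_off // oner_eq0.
- exact: pqS.
Qed.

Lemma still_of p q s : p != q -> mono s -> tdeg s = unit_deg p q ->
  (L s p q)`_0 != 0 -> (L s p q)`_1 = 0 -> still p q.
Proof.
by move=> pq ms ds s0 s1; apply: still_sym; [rewrite eq_sym|exact: still_sym_of pq ms ds s0 s1].
Qed.

(** Induction on the height [q - p], starting from the normalised superdiagonal.
    The [(p, q)] entry of [[[D, s], s']], with [s] and [s'] of heights
    [q - p - 1] and [1], involves only stationary entries, and it is nonzero
    because [ad D] has distinct eigenvalues at the two positions of [s]. *)
Lemma still_upper l (p q : 'I_n) : q = (p + l.+1)%N :> nat -> still p q.
Proof.
elim: l p q => [|l IHl] p q qE.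
  have pq : p != q by rewrite -val_eqE /= qE addn1 ltn_eqF.
  apply: (@still_of p q (elem p q ord0)) => //; rewrite L_elem.
    by rewrite xline0 base_off // oner_eq0.
  by rewrite xline1 dir_gauge // qE addn1.
have qn := ltn_ord q.
have rn : (p + l.+1 < n)%N by lia.
have p1n : (p.+1 < n)%N by lia.
pose r := Ordinal rn; pose p1 := Ordinal p1n.
have pp1 : p != p1 by rewrite -val_eqE /= ltn_eqF.
have pr : p != r by rewrite -val_eqE /=; lia.
have rq : r != q by rewrite -val_eqE /= qE; lia.
have pq : p != q by rewrite -val_eqE /= qE; lia.
have d1 : unit_deg r q = unit_deg p p1.
  by rewrite (@unit_deg_nat _ r q 1) ?(@unit_deg_nat _ p p1 1) //= ?qE ?addn1 // !addnS.
have dl : unit_deg p1 q = unit_deg p r.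
  by rewrite (@unit_deg_nat _ p1 q l.+1) ?(@unit_deg_nat _ p r l.+1) //= qE !addnS.
pose s := TLie ad_diag (elem p r ord0); pose s' := elem r q ord0.
have ds : tdeg s = unit_deg p r by rewrite /= add0r.
have LE : L (TLie s s') p q = L s p r * L s' r q - L s' p p1 * L s p1 q.
  rewrite meval_lie.
  rewrite (big_only1 r) // => [|j jr _]; last first.
    by rewrite (@meval_supp _ polyC _ s) ?mul0r // ds (inj_eq (@unit_deg_inj _ p)).
  rewrite (big_only1 p1) // => j jr _.
  by rewrite (@meval_supp _ polyC _ s') ?mul0r //= d1 (inj_eq (@unit_deg_inj _ p)).
have sE i j : unit_deg i j = unit_deg p r -> i != j ->
    (L s i j)`_0 = spread K i - spread K j.
  move=> ij ij'; rewrite (L_ad_iter 1) expr1 coef0M coefB !xline0 /base !eqxx /=.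
  by rewrite mxE /= ij eqxx xline0 base_off // mulr1.
have s'E i j : unit_deg i j = unit_deg r q -> i != j -> (L s' i j)`_0 = 1.
  by move=> ij ij'; rewrite mxE /= ij eqxx xline0 base_off.
have p1q : p1 != q by rewrite -unit_deg_eq0 dl unit_deg_eq0.
apply: (@still_of p q (TLie s s')) => //; first by rewrite /= add0r unit_degD.
  rewrite LE coefB !coef0M !sE // !s'E // mulr1 mul1r subr_eq0.
  by apply/eqP => /(spread_inj charK pr) [E _]; case/eqP: pp1.
have s1 : (L s p r)`_1 = 0 by apply: IHl.
have s2 : (L s p1 q)`_1 = 0 by apply: IHl => //; [rewrite /= qE; lia|rewrite ds dl].
have st : forall i j : 'I_n, j = i.+1 :> nat -> unit_deg i j = unit_deg r q -> (L s' i j)`_1 = 0.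
  by move=> i j ij dij; rewrite mxE /= dij eqxx xline1 dir_gauge.
rewrite LE coefB !coef1M s1 s2 !st //= ?qE ?addnS //.
by rewrite !mulr0 !mul0r !addr0 subrr.
Qed.

Lemma direction_eq0 : y = 0.
Proof.
apply/rowP => j; rewrite mxE -dir_free; case: (enum_val j) => -[i p] q.
have [<-|pq] := eqVneq p q.
  have := @tangent_diag0 (TVar (gen_var K 0 i)) p isT erefl.
  by rewrite mxE unit_degpp /= xline1.
have off (a b : 'I_n) : (a < b)%N -> still a b.
  by move=> ab; apply: (@still_upper (b - a.+1)); lia.
have : still p q.
  case: (ltngtP p q) => [/off//|qp|/val_inj E]; last by rewrite E eqxx in pq.
  by apply: still_sym; [rewrite eq_sym|apply: off].
by move=> /(_ (elem p q i) isT erefl); rewrite L_elem xline1.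
Qed.

End Direction.
End Tangent.

(** * Lower bound on the growth *)

Section LowerBound.
Context (K : fieldType) (charK : [pchar K] =i pred0) (m k' : nat).
Local Notation n := m.+3.
Local Notation k := k'.+1.
Local Notation Gam := (vasilovsky K n).
Local Notation X := (relvar Gam k).
Local Notation idx := (idx m k').
Local Notation t := #|free_idx m k'|.
Local Notation A := (relfree Gam k).
Local Notation L y := (meval polyC (@gen K m k' _ (xline y))).
Local Notation ord_one := (ord_one m).

(** Along the lines through the base point, values there do not depend on the
    direction and derivatives depend on it linearly. *)
Lemma L_first_order a (y z : 'rV[K]_t) s :
  (forall p q, (L (a *: y + z) s p q)`_0 = (L z s p q)`_0) /\
  (forall p q, (L y s p q)`_0 = (L z s p q)`_0) /\
  (forall p q, (L (a *: y + z) s p q)`_1 = a * (L y s p q)`_1 + (L z s p q)`_1).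
Proof.
elim: s => [v||s [A0 [B0 A1]] s' [A0' [B0' A1']]|c s [A0 [B0 A1]]|
            s [A0 [B0 A1]] s' [A0' [B0' A1']]].
- split=> [p q|]; last split=> p q; rewrite /= !mxE; case: ifP => _.
  + by rewrite !xline0.
  + by [].
  + by rewrite !xline0.
  + by [].
  + by rewrite !xline1 dir_linear.
  + by rewrite !coef0 mulr0 addr0.
- by split=> [p q|]; last split=> p q; rewrite /= !mxE !coef0 ?mulr0 ?addr0.
- split=> [p q|]; last split=> p q; rewrite /= !mxE !coefD.
  + by rewrite A0 A0'.
  + by rewrite B0 B0'.
  + by rewrite A1 A1'; ring.
- split=> [p q|]; last split=> p q; rewrite /= !mxE !coefCM.
  + by rewrite A0.
  + by rewrite B0.
  + by rewrite A1; ring.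
split=> [p q|]; last split=> p q; rewrite !meval_lie !coefB !coef_sum.
- by congr (_ - _); apply: eq_bigr => r _; rewrite !coef0M A0 A0'.
- by congr (_ - _); apply: eq_bigr => r _; rewrite !coef0M B0 B0'.
rewrite mulrBr !mulr_sumr addrACA -opprD -!big_split /=.
congr (_ - _); apply: eq_bigr => r _.
  by rewrite !coef1M A0 A0' A1 A1' B0 B0'; ring.
by rewrite !coef1M A0 A0' A1 A1' B0 B0'; ring.
Qed.

(** Elements of degree zero are diagonal at every point, so they act on the
    [(0, 1)] entry through this difference of entries. *)
Definition root01 (S : comNzRingType) (B : 'M[S]_n) : S :=
  B ord0 ord0 - B ord_one ord_one.

(** The gradient, along the slice at the base point, of the function by which
    [ad h] acts on the [(0, 1)] entry. *)
Definition gradient (h : lieTerm K X) : 'cV[K]_t :=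
  \col_j (root01 (L (delta_mx 0 j) h))`_1.

Lemma gradientE h y : y *m gradient h = ((root01 (L y h))`_1)%:M.
Proof.
pose f (y : 'rV[K]_t) : K := (root01 (L y h))`_1.
have flin a u v : f (a *: u + v) = a * f u + f v.
  by have [_ [_ A1]] := L_first_order a u v h; rewrite /f /root01 !coefB !A1; ring.
have f0 : f 0 = 0.
  by have := flin (-1) 0 0; rewrite scaler0 addr0 mulN1r addNr.
apply/matrixP => i j; rewrite !ord1 mxE [RHS]mxE eqxx mulr1n -/(f y).
rewrite [in RHS](row_sum_delta y).
rewrite (eq_bigr (fun j => y 0 j * f (delta_mx 0 j))) => [|l _]; last by rewrite mxE.
by elim/big_rec2: _ => [|l u w _ IH]; rewrite ?f0 // flin IH.
Qed.

(** Rigidity provides degree-zero elements whose roots have an invertible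
    Jacobian at the base point. *)
Lemma jacobian_exists : exists (h : 'I_t -> lieTerm K X) (M : 'M[K]_t),
  [/\ M \in unitmx, forall j, mono (h j) /\ tdeg (h j) = 0 &
      forall y j, (root01 (L y (h j)))`_1 = (y *m M) 0 j].
Proof.
pose S := [set u | exists2 h, mono h /\ tdeg h = 0 & u = gradient h].
have [|M Mu MS] := @unitmx_of_forms K t S.
  move=> y yS; apply: (direction_eq0 charK) => h mh h0.
  have := yS (gradient h) _; rewrite gradientE => /(_ (ex_intro2 _ _ h (conj mh h0) erefl)).
  by move=> /matrixP/(_ 0 0); rewrite !mxE eqxx mulr1n.
have /choice[h hP] : forall j, exists h : lieTerm K X,
    (mono h /\ tdeg h = 0) /\ col j M = gradient h.
  by move=> j; have [h ? ?] := MS j; exists h.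
exists h, M; split=> // [j|y j]; first by have [] := hP j.
have := congr1 (fun u => (y *m u) 0 0) (hP j).2.
rewrite gradientE [RHS]mxE eqxx mulr1n => <-; rewrite !mxE.
by apply: eq_bigr => l _; rewrite mxE.
Qed.

Lemma horner_L (y : 'rV[K]_t) s c p q :
  (L y s p q).[c] = at_pt (pt (c *: y)) (term_rel s) p q.
Proof.
rewrite at_term_rel; last exact: (trace_free_pt charK).
transitivity ((map_mx (horner_eval c) (L y s)) p q); first by rewrite mxE.
rewrite map_meval; congr ((_ : 'M[K]_n) p q).
transitivity (meval (horner_eval c \o polyC) (gen (pt (c *: y))) s).
  apply: eq_meval => v; rewrite map_gen; congr gen; apply/funext => u.
  rewrite /= /horner_eval /xline !hornerE /= /pt; congr (_ + _).
  by rewrite dirZ.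
by congr meval; apply/funext => a; rewrite /= /horner_eval hornerC.
Qed.

Section Products.
Context (h : 'I_t -> A) (kap : 'I_t -> K).

(** Subtracting the value [kap j] at the base point makes [ad (h j)] act on the
    [(0, 1)] entry by a function that vanishes there. *)
Definition shifted_ad (j : 'I_t) (w : A) : A := lie (h j) w - kap j *: w.

Definition ad_prod (s : seq 'I_t) (e : 'I_t -> nat) (w : A) : A :=
  foldr (fun j => iter (e j) (shifted_ad j)) w s.

Lemma at_ad_prod x s e w : trace_free x ->
  (forall j p q, p != q -> at_pt x (h j) p q = 0) ->
  at_pt x (ad_prod s e w) ord0 ord_one =
  (\prod_(j <- s) (root01 (at_pt x (h j)) - kap j) ^+ e j) * at_pt x w ord0 ord_one.
Proof.
move=> x0 hdiag.
have step j u : at_pt x (shifted_ad j u) ord0 ord_one =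
    (root01 (at_pt x (h j)) - kap j) * at_pt x u ord0 ord_one.
  rewrite /shifted_ad -scaleNr addrC at_linear // at_lie // !mxE.
  rewrite (big_only1 ord0) // => [|r r0 _]; last by rewrite hdiag ?mul0r // eq_sym.
  rewrite (big_only1 ord_one) // => [|r r0 _]; last by rewrite hdiag ?mulr0.
  by rewrite /root01; ring.
elim: s => [|j s IHs] /=; first by rewrite big_nil mul1r.
rewrite big_cons -mulrA -IHs.
by elim: (e j) => [|d IHd]; rewrite ?mul1r //= step IHd mulrA exprS.
Qed.

End Products.

Section Words.
Context (V : set A).

Lemma word_span_subspace l : Defs.subspace (word_span V l).
Proof. exact: lspan_subspace. Qed.

Lemma word_span_leq l l' : (l <= l')%N -> word_span V l `<=` word_span V l'.
Proof.
move=> ll; apply: lspan_min; first exact: word_span_subspace.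
by move=> x [i il xi]; apply: sub_lspan; exists i => //; apply: leq_trans ll.
Qed.

Lemma word_span_lie l l' x y :
  word_span V l x -> word_span V l' y -> word_span V (l + l') (lie x y).
Proof.
move=> xl yl; have W := word_span_subspace (l + l').
move: x xl; apply: lspan_min.
  split=> [|a u v uP vP]; first by rewrite (lieD0 y).1; case: W.
  by rewrite lie_linearl; apply: W.2.
move=> x [i il xi]; move: y yl; apply: lspan_min.
  split=> [|a u v uP vP]; first by rewrite (lieD0 x).2; case: W.
  by rewrite lie_linearr; apply: W.2.
move=> y [j jl yj]; apply: sub_lspan; exists (i + j)%N; first exact: leq_add.
exact: word_lie.
Qed.

Lemma generates_word_span : generates V -> forall x, exists l, word_span V l x.
Proof.
move=> /(_ [set x | exists l, word_span V l x]) VP x.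
suff E : [set x | exists l, word_span V l x] = setT by have : setT x by []; rewrite -E.
apply: VP.
- split=> [|a u v [l ul] [l' vl]].
    by exists 0%N; case: (word_span_subspace 0).
  exists (maxn l l'); apply: (word_span_subspace _).2.
    exact: word_span_leq (leq_maxl _ _) _ ul.
  exact: word_span_leq (leq_maxr _ _) _ vl.
- by move=> u v [l ul] [l' vl]; exists (l + l')%N; apply: word_span_lie.
- by move=> v Vv; exists 1%N; apply: sub_lspan; exists 1%N => //; apply: word_gen.
Qed.

Lemma word_span_ad_prod (h : 'I_t -> A) kap N s e d w l :
  (forall j, word_span V N (h j)) -> (forall j, e j <= d)%N ->
  word_span V l w -> word_span V (N * (size s * d) + l) (ad_prod h kap s e w).
Proof.
move=> hN ed wl; elim: s => [|j s IHs] /=; first by rewrite mul0n muln0.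
rewrite mulSn mulnDr -addnA.
apply: (@word_span_leq (N * e j + (N * (size s * d) + l))).
  by rewrite leq_add2r leq_mul2l ed orbT.
elim: (e j) => [|c IHc] /=; first by rewrite muln0.
rewrite mulnS -addnA /shifted_ad addrC -scaleNr.
apply: (word_span_subspace _).2; first exact: word_span_leq (leq_addl _ _) _ IHc.
exact: word_span_lie.
Qed.

End Words.

Lemma at_term_rel_diag (x : idx -> K) (h : lieTerm K X) p q : trace_free x -> mono h -> tdeg h = 0 -> p != q ->
  at_pt x (term_rel h) p q = 0.
Proof. by move=> x0 mh h0 pq; rewrite at_term_rel // meval_supp // h0 unit_deg_eq0. Qed.

(** The products with exponents at most [d] form an independent family of
    [d.+1 ^ t] elements, spanned by words of length linear in [d]. *)
Lemma growth_lower (V : set A) : finite_set V -> generates V ->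
  exists2 C, (0 < C)%N & forall l, (C <= l)%N -> (l ^ t <= C ^ t * growth V l)%N.
Proof.
move=> Vfin Vgen; have [h [M [Mu hmono hM]]] := jacobian_exists.
pose w0 : A := term_rel (elem K ord0 ord_one ord0).
have [N hN wN] : exists2 N, forall j, word_span V N (term_rel (h j)) & word_span V N w0.
  have /choice[f fP] := fun j => generates_word_span Vgen (term_rel (h j)).
  have [l wl] := generates_word_span Vgen w0.
  exists (maxn (\max_j f j) l) => [j|]; last exact: word_span_leq (leq_maxr _ _) _ wl.
  by apply: word_span_leq (fP j); apply: leq_trans (leq_maxl _ _); apply: leq_bigmax.
pose kap j := (root01 (L 0 (h j)))`_0.
pose w d (e : {ffun 'I_t -> 'I_d.+1}) : A :=
  ad_prod (fun j => term_rel (h j)) kap (enum 'I_t) (val \o e) w0.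
have w_indep d : indep (@w d).
  move=> c c0; pose P y j := root01 (L y (h j)) - (kap j)%:P.
  apply: (@power_products_indep K charK d.+1 t M P) => // [y j|y j|y s].
  - rewrite coefB coefC /= /kap /root01 !coefB.
    have [_ [B0 _]] := L_first_order 0 y 0 (h j).
    by rewrite !B0 subrr.
  - by rewrite coefB coefC subr0 hM.
  have x0 : trace_free (pt (s *: y)) by apply: (trace_free_pt charK).
  have := congr1 (fun B : 'M[K]_n => B ord0 ord_one) (at_sum x0 c (@w d)).
  rewrite c0 summxE (_ : at_pt _ 0 = 0); last by rewrite -term_rel0 at_term_rel.
  rewrite mxE => E; rewrite [RHS]E; apply: eq_bigr => e _.
  rewrite mxE at_ad_prod //; last first.
    by move=> j p q; apply: at_term_rel_diag => //; have [] := hmono j.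
  rewrite [at_pt _ w0 _ _](_ : _ = 1); last first.
    by rewrite at_term_rel // mxE /= eqxx pt_gauge.
  rewrite mulr1 big_enum; congr (_ * _); apply: eq_bigr => j _ /=.
  by rewrite /P hornerD hornerN hornerC /root01 hornerD hornerN !horner_L.
have [c [_ lb]] := growth_bounds charK Vfin.
pose C := (N.+1 * t.+1)%N; exists C => // l Cl.
pose d := (l %/ C)%N; have d0 : (0 < d)%N by rewrite divn_gt0.
have aux d' t' : (0 < d')%N -> (N * (t' * d') + N <= d' * (N.+1 * t'.+1))%N by nia.
have wl e : word_span V l (@w d e).
  apply: (@word_span_leq V (N * (size (enum 'I_t) * d) + N)).
    rewrite size_enum_ord; apply: leq_trans (leq_trunc_div l C); rewrite -/d /C.
    exact: aux.
  by apply: word_span_ad_prod => // j; rewrite -ltnS /=.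
have := lb l _ _ (w_indep d) wl; rewrite card_ffun !card_ord => gl.
apply: leq_trans (_ : C ^ t * d.+1 ^ t <= _)%N; last by rewrite leq_mul2l gl orbT.
have lC : (l <= C * d.+1)%N by rewrite mulnC ltnW // ltn_ceil.
by rewrite -expnMn; case: (posnP t) => [->//|t0]; rewrite leq_exp2r.
Qed.

End LowerBound.

(** * The growth exponent *)

Lemma growth_exponent_squeeze (R : realType) (g : nat -> nat) (t a c C : nat) :
  (0 < C)%N -> (forall l, g l <= a * (c * l).+1 ^ t)%N ->
  (forall l, (C <= l)%N -> (l ^ t <= C ^ t * g l)%N) ->
  limn_esup (fun l => (ln (g l)%:R / ln l%:R : R)%:E) = t%:R%:E.
Proof.
move=> C0 ub lb.
pose D := (a * c.+1 ^ t)%N; pose B : R := t%:R * ln C%:R + ln D.+1%:R.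
have lnS (x : nat) : 0 <= ln x.+1%:R :> R by rewrite ln_ge0 // ler1n.
have BE l : (C <= l)%N -> (2 <= l)%N -> `|t%:R * ln l%:R - ln (g l)%:R| <= B.
  move=> Cl l2; have l0 : (0 < l)%N by apply: leq_trans l2.
  have g0 : (0 < g l)%N.
    have := lb l Cl; case: (g l) => //; rewrite muln0 leqn0 expn_eq0.
    by rewrite eqn0Ngt l0.
  have lnX (x : nat) : (0 < x)%N -> ln (x ^ t)%:R = t%:R * ln x%:R :> R.
    by move=> x0; rewrite natrX lnXn ?ltr0n // mulr_natl.
  have lnle (x y : nat) : (0 < x)%N -> (x <= y)%N -> ln x%:R <= ln y%:R :> R.
    move=> x0 xy; rewrite ler_ln ?posrE ?ltr0n ?ler_nat //.
    exact: leq_trans xy.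
  have lnM (x y : nat) : (0 < x)%N -> (0 < y)%N -> ln (x * y)%:R = ln x%:R + ln y%:R :> R.
    by move=> x0 y0; rewrite natrM lnM // posrE ltr0n.
  have lo : t%:R * ln l%:R <= t%:R * ln C%:R + ln (g l)%:R :> R.
    rewrite -!lnX // -lnM ?expn_gt0 ?C0 //.
    by apply: lnle (lb l Cl); rewrite expn_gt0 l0.
  have hi : ln (g l)%:R <= ln D.+1%:R + t%:R * ln l%:R :> R.
    rewrite -lnX // -lnM ?expn_gt0 ?l0 //; apply: lnle => //.
    apply: leq_trans (ub l) _; apply: (@leq_trans (D * l ^ t)); last by rewrite leq_mul2r leqnSn orbT.
    rewrite /D -mulnA -expnMn leq_mul2l; apply/orP; right.
    have le : ((c * l).+1 <= c.+1 * l)%N by nia.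
    by case: (posnP t) => [->//|t0]; rewrite leq_exp2r.
  have := lnS D; have := lnS C.-1; rewrite prednK // => lC lD.
  have tC : 0 <= t%:R * ln C%:R :> R by rewrite mulr_ge0.
  rewrite ler_norml /B; lra.
apply: (@cvg_limn_einf_sup R _ t%:R%:E _).2; apply: cvg_EFin.
  by near=> l.
apply/cvgrPdist_le => e e0.
have B0 : 0 <= B by rewrite addr_ge0 // mulr_ge0 // -(prednK C0).
near=> l.
have Cl : (C <= l)%N by near: l; exact: nbhs_infty_ge.
have l2 : (2 <= l)%N by near: l; exact: nbhs_infty_ge.
have lB : expR (B / e) <= l%:R.
  near: l; exact: nbhs_infty_ger.
have lnl : 0 < ln l%:R :> R by rewrite ln_gt0 // ltr1n.
have lnB : B / e <= ln l%:R.
  rewrite -[B / e]expRK ler_ln ?posrE ?expR_gt0 //.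
  by rewrite ltr0n; apply: leq_trans l2.
rewrite /= (_ : _ - _ = (t%:R * ln l%:R - ln (g l)%:R) / ln l%:R); last first.
  by field; apply: lt0r_neq0.
rewrite normrM normfV (gtr0_norm lnl) ler_pdivrMr //.
apply: le_trans (BE l Cl l2) _.
by rewrite mulrC -ler_pdivrMr.
Unshelve. all: by end_near.
Qed.

Section FiniteGeneration.
Context (K : fieldType) (m k' : nat).
Local Notation n := m.+3.
Local Notation k := k'.+1.
Local Notation X := (relvar (vasilovsky K n) k).

Lemma relfree_fin_gen :
  exists2 V : set (relfree (vasilovsky K n) k), finite_set V & generates V.
Proof.
pose f (w : 'Z_n * 'I_k) := term_rel (TVar (gen_var K w.1 w.2)).
exists (range f); first exact/finite_image/finite_finset.
move=> B BP Blie Bvar; apply/seteqP; split=> // a _.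
have [s ->] := term_rel_surj a; elim: s => [v||s Bs s' Bs'|c s Bs|s Bs s' Bs'].
- by rewrite -(gen_varK v); apply: Bvar; exists (\val v.1, v.2).
- by rewrite term_rel0; case: BP.
- by rewrite term_relD; apply: subspaceD.
- by rewrite term_relZ; apply: subspaceZ.
- by rewrite term_rel_lie; apply: Blie.
Qed.

End FiniteGeneration.

Theorem theorem4p8 (R : realType) (K : fieldType) (charK : [pchar K] =i pred0)
    (n k : nat) (hn : (3 <= n)%N) (hk : (1 <= k)%N) :
  has_graded_GKdim (vasilovsky K n) k
    ((k%:R * (n%:R ^+ 2 - 1) - n%:R + 1)%:E : \bar R).
Proof.
case: n hn => [|[|[|m]]] // _; case: k hk => [//|k'] _.
split; first exact: relfree_fin_gen.
move=> V Vfin Vgen; have [c [ub _]] := growth_bounds charK Vfin.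
have [C C0 lb] := growth_lower charK Vfin Vgen.
rewrite /growth_exponent (growth_exponent_squeeze R C0 ub lb); congr EFin.
have /(congr1 (fun x : nat => x%:R : R)) := card_free_idx m k'.
rewrite !natrD natrM natrX /= => E.
have -> : m.+3%:R = m.+2%:R + 1 :> R by rewrite -natr1.
rewrite -natr1 in E; nra.
Qed.
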